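(* Let $G$ be a countable discrete group and let $H\in\mathrm{Sub}_{\rm w-par}(G)$, i.e. $H$ is a weakly parabolic subgroup of $G$. (i) The regular representation $\lambda_G$ factorizes to a representation of $C^*_{\lambda_{G/H}}(G)$ (that is, $\lambda_{G/H}(g)\mapsto\lambda_G(g)$ extends to a $*$-homomorphism on $C^*_{\lambda_{G/H}}(G)$); so the reduced $C^*$-algebra $C^*_{\rm red}(G)$ is isomorphic to $C^*_{\lambda_{G/H}}(G)/I$, where $I$ is the kernel of $\lambda_G$ in $C^*_{\lambda_{G/H}}(G)$. (ii) $I$ is the largest proper ideal of $C^*_{\lambda_{G/H}}(G)$: every proper two-sided closed ideal of $C^*_{\lambda_{G/H}}(G)$ is contained in $I$.
   Context: $\lambda_{G/H}$ denotes the quasi-regular representation of $G$ on $\ell^2(G/H)$, $\lambda_G$ is the left regular representation on $\ell^2(G)$. For a unitary representation $\pi$ of $G$ on a Hilbert space $\mathcal{H}$, $C^*_\pi(G)$ is the norm closure in $\mathcal{B}(\mathcal{H})$ of the linear span of $\pi(G)$; $C^*_{\rm red}(G)=C^*_{\lambda_G}(G)$. An action of $G$ by homeomorphisms on a compact Hausdorff space $X$ is minimal if every orbit is dense; it is strongly proximal if for every $\nu$ in the space $\mathrm{Prob}(X)$ of probability measures on $X$, the weak* closure of the orbit $G\nu$ contains a point measure $\delta_x$, $x\in X$. It is a boundary action if it is minimal and strongly proximal. An action on a Hausdorff space $X$ is topologically free if for every $g\in G\setminus\{e\}$ the set $\{x\in X: gx=x\}$ has empty interior. A subgroup $H$ of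 $G$ is weakly parabolic if there exists a topologically free boundary action of $G$ on a compact space $X$ such that $H$ has a fixed point in $\mathrm{Prob}(X)$. $\mathrm{Sub}_{\rm w-par}(G)$ is the set of weakly parabolic subgroups of $G$. *)

(* Defs.v *)
From HB Require Import structures.
From mathcomp Require Import all_boot all_order all_algebra.
From mathcomp Require Import complex ring.
From mathcomp Require Import all_classical all_reals all_analysis.
From mathcomp Require analysis.showcase.summability.
Import numFieldNormedType.Exports.
Import Order.TTheory GRing.Theory Num.Theory.

Set Implicit Arguments.
Unset Strict Implicit.
Unset Printing Implicit Defensive.

Local Open Scope classical_set_scope.
Local Open Scope ring_scope.

Record left_action (G : groupType) (S : Type) := LeftAction {
  act :> G -> S -> S;
  act_one : forall x, act 1%g x = x;
  act_mul : forall g h x, act (g * h)%g x = act g (act h x) }.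

Section Cosets.
Variable G : groupType.

Definition left_mul : left_action G G :=
  LeftAction (fun x : G => mul1g x) (fun g h x : G => esym (mulgA g h x)).

Variable H : groupClosed G.

Definition left_coset (g : G) : set G :=
  [set (g * h)%g | h in [set h | h \in H]].

Definition coset_space : choiceType := set_type (range left_coset).

Lemma coset_translateP (g : G) (c : coset_space) :
  [set (g * x)%g | x in val c] \in range left_coset.
Proof.
have := valP c; rewrite !inE => -[k _ <-]; exists (g * k)%g => //.
by rewrite /left_coset image_comp; apply: eq_imagel => h _ /=; rewrite mulgA.
Qed.

Definition coset_translate (g : G) (c : coset_space) : coset_space :=
  SigSub (coset_translateP g c).

Lemma coset_translate1 c : coset_translate 1%g c = c.
Proof.
apply: val_inj => /=; apply/seteqP; split=> [_ [x cx <-]|x cx].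
  by rewrite mul1g.
by exists x => //; rewrite mul1g.
Qed.

Lemma coset_translateM g h c :
  coset_translate (g * h)%g c = coset_translate g (coset_translate h c).
Proof.
apply: val_inj => /=; rewrite image_comp.
by apply: eq_imagel => x _ /=; rewrite mulgA.
Qed.

Definition coset_mul : left_action G coset_space :=
  LeftAction coset_translate1 coset_translateM.

End Cosets.

Definition square_summable (R : realType) (S : choiceType) :
    {pred S -> R[i]^o} :=
  fun f => `[< (\esum_(s in [set: S]) ((Normc.normc (f s)) ^+ 2)%:E < +oo)%E >].

Section SquareSummable.
Variables (R : realType) (S : choiceType).
Implicit Types f g : S -> R[i]^o.

Lemma square_summableD f g :
  f \in square_summable (R := R) (S := S) -> g \in square_summable (R := R) (S := S) ->
  f + g \in square_summable (R := R) (S := S).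
Proof.
move=> /asboolP hf /asboolP hg; apply/asboolP.
pose F s := ((Normc.normc (f s)) ^+ 2)%:E.
pose K s := ((Normc.normc (g s)) ^+ 2)%:E.
have F0 s : (0 <= F s)%E by rewrite lee_fin sqr_ge0.
have K0 s : (0 <= K s)%E by rewrite lee_fin sqr_ge0.
apply: (@le_lt_trans _ _
  (\esum_(s in [set: S]) ((F s + F s) + (K s + K s)))%E).
  apply: le_esum => s _; rewrite -!EFinD lee_fin.
  have a0 : 0 <= Normc.normc (f s + g s).
    by case: (f s + g s) => u v /=; exact: sqrtr_ge0.
  apply: (@le_trans _ _ ((Normc.normc (f s) + Normc.normc (g s)) ^+ 2)).
    have h := le_normcD (f s) (g s).
    by rewrite ler_sqr ?nnegrE//; exact: (le_trans a0).
  rewrite -subr_ge0; set x := Normc.normc _; set y := Normc.normc _.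
  rewrite (_ : _ - _ = (x - y) ^+ 2) ?sqr_ge0//.
  by ring.
rewrite esumD; [|by move=> *; rewrite adde_ge0 ..].
by rewrite !esumD// !lte_add_pinfty.
Qed.

Lemma square_summableZ (c : R[i]) f :
  f \in square_summable (R := R) (S := S) -> c *: f \in square_summable (R := R) (S := S).
Proof.
move=> /asboolP hf; apply/asboolP.
pose F s := ((Normc.normc (f s)) ^+ 2)%:E.
have F0 s : (0 <= F s)%E by rewrite lee_fin sqr_ge0.
apply: (@le_lt_trans _ _
  (((Normc.normc c) ^+ 2)%:E * \esum_(s in [set: S]) F s)%E); last first.
  by rewrite lte_mul_pinfty// lee_fin sqr_ge0.
apply: ge_ereal_sup => _ [X [finX XS] <-].
rewrite (eq_fsbigr (fun s => ((Normc.normc c) ^+ 2)%:E * F s)%E); last first.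
  by move=> s _; rewrite -EFinM -exprMn -Normc.normcM.
rewrite -ge0_mule_fsumr//; apply: lee_wpmul2l; first by rewrite lee_fin sqr_ge0.
by apply: esum_ge; exists X.
Qed.

Lemma square_summable_submod :
  submod_closed (square_summable (R := R) (S := S)).
Proof.
split=> [|c f g hf hg].
  apply/asboolP; rewrite esum1 ?ltry// => s _.
  by rewrite [Normc.normc _]Normc.normc0 expr0n.
by apply: square_summableD => //; exact: square_summableZ.
Qed.

End SquareSummable.

HB.instance Definition _ (R : realType) (S : choiceType) :=
  GRing.isSubmodClosed.Build R[i] (S -> R[i]^o) (square_summable (R := R) (S := S))
    (square_summable_submod R S).

Record ell2 (R : realType) (S : choiceType) := Ell2 {
  ell2_fun :> S -> R[i]^o;
  ell2P : ell2_fun \in square_summable (R := R) (S := S) }.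

HB.instance Definition _ (R : realType) (S : choiceType) :=
  [isSub for @ell2_fun R S].
HB.instance Definition _ (R : realType) (S : choiceType) :=
  [Choice of ell2 R S by <:].
HB.instance Definition _ (R : realType) (S : choiceType) :=
  [SubChoice_isSubLmodule of ell2 R S by <:].

(* `inner f g` is the unordered sum of f(s) * conj(g(s)) over s in S, that is,
   the limit of the partial sums along the net of finite subsets of S. *)
Definition inner (R : realType) (S : choiceType) (f g : ell2 R S) : R[i] :=
  summability.sum (fun s => f s * (g s)^*%C : R[i]^o).

Definition ell2_norm (R : realType) (S : choiceType) (f : ell2 R S) : R :=
  Num.sqrt (fine (\esum_(s in [set: S]) ((Normc.normc (f s)) ^+ 2)%:E)).

(* Operators are bare maps; sums and scalings of operators are pointwise and
   the product is composition. *)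
Notation operator R S := (ell2 R S -> ell2 R S).

Section Operators.
Variables (R : realType) (S : choiceType).
Implicit Types (T : operator R S) (E A I : set (operator R S)).

Definition bounded_operator T : Prop :=
  linear T /\ exists M : R, forall x, ell2_norm (T x) <= M * ell2_norm x.

Definition opnorm T : R :=
  sup [set ell2_norm (T x) | x in [set x | ell2_norm x <= 1]].

Definition is_adjoint T T' : Prop :=
  forall x y, inner (T x) y = inner x (T' y).

Definition lin_span E : set (operator R S) :=
  [set T | exists (n : nat) (c : 'I_n -> R[i]) (t : 'I_n -> operator R S),
     (forall i, E (t i)) /\ T = \sum_(i < n) c i *: t i].

Definition norm_closure E : set (operator R S) :=
  [set T | bounded_operator T /\
     forall e : R, 0 < e -> exists2 T', E T' & opnorm (T - T') < e].

Definition cstar_rep (G : groupType) (pi : G -> operator R S) :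
    set (operator R S) :=
  norm_closure (lin_span (range pi)).

Record closed_ideal A I : Prop := ClosedIdeal {
  closed_ideal_sub : I `<=` A;
  closed_ideal0 : I 0;
  closed_ideal_linear : forall (c : R[i]) s t, I s -> I t -> I (c *: s + t);
  closed_ideal_mull : forall a t, A a -> I t -> I (a \o t);
  closed_ideal_mulr : forall a t, A a -> I t -> I (t \o a);
  closed_ideal_closed : norm_closure I `<=` I }.

Definition proper_closed_ideal A I : Prop := closed_ideal A I /\ I <> A.

Definition ideal_coset I T : set (operator R S) := [set T + t | t in I].

Definition ideal_quotient A I : set (set (operator R S)) :=
  [set ideal_coset I a | a in A].

End Operators.

Section Morphisms.
Variables (R : realType) (S S' : choiceType).

(* *-homomorphism from the *-algebra A of operators on l^2(S) into
   B(l^2(S')); only the values of Phi on A matter. *)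
Record star_hom (A : set (operator R S)) (Phi : operator R S -> operator R S') :
    Prop := StarHom {
  star_hom_bounded : forall a, A a -> bounded_operator (Phi a);
  star_hom_linear : forall (c : R[i]) a b, A a -> A b ->
    Phi (c *: a + b) = c *: Phi a + Phi b;
  star_hom_mul : forall a b, A a -> A b -> Phi (a \o b) = Phi a \o Phi b;
  star_hom_adjoint : forall a b, A a -> A b -> is_adjoint a b ->
    is_adjoint (Phi a) (Phi b) }.

Definition star_hom_kernel (A : set (operator R S))
    (Phi : operator R S -> operator R S') : set (operator R S) :=
  A `&` [set a | Phi a = 0].

(* The quotient *-algebra A/I consists of the cosets a + I, and its operations
   are those of A on representatives: a map Psi on A/I is a *-homomorphism iff
   its composite with the projection a |-> a + I is one on A. *)
Definition quotient_isomorphic (A I : set (operator R S))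
    (B : set (operator R S')) : Prop :=
  exists Psi : set (operator R S) -> operator R S',
    star_hom A (fun a => Psi (ideal_coset I a)) /\
    set_bij (ideal_quotient A I) B Psi.

End Morphisms.

Section PermutationRep.
Variables (R : realType) (G : groupType) (S : choiceType).
Variable a : left_action G S.

Lemma perm_rep_subproof (g : G) (f : ell2 R S) :
  (fun s => f (a g^-1%g s)) \in square_summable (R := R) (S := S).
Proof.
have /asboolP hf := ell2P f; apply/asboolP.
rewrite -(@reindex_esum _ _ _ [set: S] [set: S] (a g^-1%g)
  (fun s => ((Normc.normc (f s)) ^+ 2)%:E))//.
split=> // [x y _ _ e|x _]; last by exists (a g x) => //; rewrite -act_mul mulVg act_one.
by rewrite -(act_one a x) -(mulgV g) act_mul e -act_mul mulgV act_one.
Qed.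

Definition perm_rep (g : G) : operator R S :=
  fun f => Ell2 (perm_rep_subproof g f).

End PermutationRep.

Definition left_regular (R : realType) (G : groupType) : G -> operator R G :=
  perm_rep (left_mul G).

Definition quasi_regular (R : realType) (G : groupType) (H : groupClosed G) :
    G -> operator R (coset_space H) :=
  perm_rep (coset_mul H).

Arguments left_regular R G : clear implicits.
Arguments quasi_regular R {G} H.

Definition borel (X : ptopologicalType) := g_sigma_algebraType (@open X).

Section Boundary.
Variables (R : realType) (G : groupType) (X : ptopologicalType).
Variable a : left_action G X.
Implicit Types mu nu : probability (borel X) R.

(* X need not be metrizable, so Prob(X), viewed inside the dual of C(X),
   consists of the regular Borel probability measures. *)
Definition Prob : set (probability (borel X) R) :=
  [set mu | forall A : set (borel X), measurable A ->
     mu A = ereal_inf [set mu U | U in [set U : set X | open U /\ A `<=` U]] /\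
     mu A = ereal_sup [set mu K | K in [set K : set X | compact K /\ K `<=` A]]].

(* The weak* topology is that of pointwise convergence on C(X); real-valued
   continuous functions give the same topology as complex-valued ones. *)
Definition weak_star : Type :=
  initial_topology (fun mu =>
    (fun f : continuousType X R => \int[mu]_x f x) :
      {ptws continuousType X R -> R}).

(* nu is the translate g mu, with (g mu)(A) = mu(g^-1 A). *)
Definition is_translate (g : G) mu nu : Prop :=
  forall A : set (borel X), measurable A -> nu A = mu (a g @^-1` A).

Definition measure_orbit nu : set (probability (borel X) R) :=
  [set mu | exists g, is_translate g nu mu].

Definition minimal_action : Prop :=
  forall x, dense [set a g x | g in [set: G]].

(* Translates of regular measures and point masses are regular on a compact
   Hausdorff space, so that the closure may be computed among all Borel
   probability measures. *)
Definition strongly_proximal : Prop :=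
  forall nu, Prob nu ->
    exists x : X, closure (measure_orbit nu : set weak_star) (\d_(x : borel X)).

Definition boundary_action : Prop :=
  [/\ compact [set: X], hausdorff_space X, (forall g, continuous (a g)),
      minimal_action & strongly_proximal].

Definition topologically_free : Prop :=
  forall g : G, g <> 1%g -> interior [set x | a g x = x] = set0.

End Boundary.

(* X is pointed: a space carrying a probability measure is nonempty. *)
Definition weakly_parabolic (R : realType) (G : groupType) (H : groupClosed G) :
    Prop :=
  exists (X : ptopologicalType) (a : left_action G X),
    [/\ boundary_action R a, topologically_free a &
        exists2 mu : probability (borel X) R,
          Prob mu & forall h, h \in H -> is_translate a h mu mu].

(* Main.v *)
From HB Require Import structures.
Require Import Defs.
From mathcomp Require Import all_boot all_order all_algebra finmap.
From mathcomp Require Import complex ring lra.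
From mathcomp Require Import all_classical all_reals all_analysis.
From mathcomp Require Import measurable_realfun.
From mathcomp Require analysis.showcase.summability.
Import numFieldNormedType.Exports.
Import Order.TTheory GRing.Theory Num.Theory.

Set Implicit Arguments.
Unset Strict Implicit.
Unset Printing Implicit Defensive.

Local Open Scope classical_set_scope.
Local Open Scope ring_scope.

(** Let H fix a probability mu on a topologically free boundary X of G.

    Everything is extracted from one property of the action of G on G/H,
    [averaging_displacement]. Given finitely many non-trivial k, topological
    freeness provides a non-empty open set U of X that is disjoint from each
    k U ([displaced_open]). Minimality and strong proximality say that every
    regular probability gives mass close to 1 to some translate of U. A minimax
    argument makes this uniform: some finite convex combination of indicators of
    translates of U is at least 1 - e on all of X ([uniform_proximality]).
    The minimax argument needs a regular measure as a counterexample; it is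
    produced by a maximal cone of functions, which gives a finitely additive
    probability on all subsets of X ([finitely_additive_minimax]), and by
    regularizing the latter ([finitely_additive_regularization]). Evaluating
    the translates of mu on the translates of U turns the indicators into
    functions m_i from G/H to [0, 1], whose convex combination is at least 1 - e
    and which satisfy m_i (c) + m_i (g_i^-1 k g_i c) <= 1
    ([weakly_parabolic_displacement]).

    Consequence 1. Some point s of G/H is moved by all the given k. Hence
    h |-> h s is injective on prescribed finite subsets of G and transports
    finitely supported vectors of l^2(G) isometrically and equivariantly to
    l^2(G/H): the norm of an element of the group ring in the regular
    representation is at most its norm in the quasi-regular one
    ([displacement_weak_containment]). So the correspondence between the two
    images of the group ring closes up to a *-homomorphism Phi ([factor_map]).
    It maps onto the reduced C*-algebra because an element of the group ring
    whose image has norm at most r can be modified, at the cost of half of that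
    norm, into one of norm at most 4 r, by iterating the cubic polynomial
    u - u u' u / M^2, where u' is the adjoint of u ([lift_step],
    [graph_closure_surj]).

    Consequence 2. Because of the functions m_i, the convex combination of the
    unitaries of the elements g_i^-1 k g_i has norm at most 2 sqrt e
    ([averaged_norm_le]). Conjugating by the g_i and averaging thus brings any
    element a of the quasi-regular C*-algebra close to the scalar tau(Phi a),
    where tau is the canonical trace. If a lies in a closed ideal J, so do these
    averages; if J is proper it contains no element close to a non-zero scalar
    ([ideal_far_from_id]), whence tau(Phi a) = 0. Applied to the translates of
    a, this says that all the matrix coefficients of Phi a vanish
    ([ideal_regular0]), so J lies in the kernel of Phi. *)

(** * The inner product of l^2(S) *)

#[local] Existing Instance summability.totally_filter.

Lemma sum_cvg (S : choiceType) (K : numFieldType) (V : normedModType K)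
    (u : S -> V) (y : V) :
  summability.partial_sum u @ summability.totally --> y -> summability.sum u = y.
Proof. by move=> h; apply: cvg_lim h; exact: norm_hausdorff. Qed.

Section InnerProduct.
Variables (R : realType) (S : choiceType).
Implicit Types (f g h : ell2 R S) (c z : R[i]).

Local Notation nrm := ell2_norm.
Local Notation psum := (@summability.partial_sum S).
Local Notation tot := (@summability.totally S).

Lemma ell2_esum_fin f :
  (\esum_(s in [set: S]) ((Normc.normc (f s)) ^+ 2)%:E)%E \is a fin_num.
Proof.
have /asboolP h := ell2P f; rewrite ge0_fin_numE//.
by apply: esum_ge0 => s _; rewrite lee_fin sqr_ge0.
Qed.

Lemma ell2_norm_ge0 f : 0 <= nrm f. Proof. exact: sqrtr_ge0. Qed.

Lemma ell2_norm_sqr f :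
  ((nrm f ^+ 2)%:E = \esum_(s in [set: S]) ((Normc.normc (f s)) ^+ 2)%:E)%E.
Proof.
rewrite sqr_sqrtr ?fineK ?ell2_esum_fin//.
apply: fine_ge0; apply: esum_ge0 => s _; by rewrite lee_fin sqr_ge0.
Qed.

Lemma partial_sumE (V : zmodType) (u : S -> V) (X : {fset S}) :
  summability.partial_sum u X = \sum_(s <- X) u s.
Proof. by rewrite /summability.partial_sum big_seq_fsetE. Qed.

Lemma fsbig_fset (u : S -> R) (X : {fset S}) :
  (\sum_(s \in [set` X]) (u s)%:E)%E = (\sum_(s <- X) u s)%:E.
Proof. by rewrite fsbig_finite//= set_fsetK sumEFin. Qed.

Lemma sum_norm_le f (X : {fset S}) :
  \sum_(s <- X) (Normc.normc (f s)) ^+ 2 <= nrm f ^+ 2.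
Proof.
rewrite -lee_fin ell2_norm_sqr; apply: esum_ge; exists [set` X].
  by split=> //; exact: finite_fset.
by rewrite fsbig_fset.
Qed.

Lemma sum_norm_gt f (e : R) : 0 < e ->
  exists X : {fset S}, nrm f ^+ 2 - e < \sum_(s <- X) (Normc.normc (f s)) ^+ 2.
Proof.
move=> e0.
have : (\esum_(s in [set: S]) ((Normc.normc (f s)) ^+ 2)%:E)%E \is a fin_num.
  exact: ell2_esum_fin.
move=> /(ub_ereal_sup_adherent e0)[_ [A [finA _] <-]].
rewrite -/(esum _ _) -ell2_norm_sqr -EFinB => h.
exists (fset_set A); rewrite -lte_fin; apply: (lt_le_trans h).
by rewrite -fsbig_fset fset_setK.
Qed.

Lemma sum_norm_mono f (X Y : {fset S}) : (X `<=` Y)%fset ->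
  \sum_(s <- X) (Normc.normc (f s)) ^+ 2 <= \sum_(s <- Y) (Normc.normc (f s)) ^+ 2.
Proof.
move=> XY; rewrite -lee_fin -!fsbig_fset; apply: lee_fsum_nneg_subset => //.
- by move=> s; rewrite !inE => sX; exact: (fsubsetP XY).
- by move=> s _; rewrite lee_fin sqr_ge0.
Qed.

Lemma normc_conj (z : R[i]) : Normc.normc z^*%C = Normc.normc z.
Proof. by case: z => a b /=; rewrite sqrrN. Qed.

Lemma normcE (z : R[i]) : `|z| = (Normc.normc z)%:C%C.
Proof. by []. Qed.

Lemma mul_conjc_normc (z : R[i]) : z * z^*%C = ((Normc.normc z) ^+ 2)%:C%C.
Proof.
case: z => a b; simpc => /=; rewrite sqr_sqrtr ?addr_ge0 ?sqr_ge0//.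
by rewrite !expr2 [a * b]mulrC addNr.
Qed.

(** Unordered summation: convergence of the finite partial sums along the net of
    finite subsets of S. *)
Definition msum (u : S -> R[i]) (z : R[i]) :=
  psum (u : S -> R[i]^o) @ tot --> (z : R[i]^o).

(** A sum of non-negative terms converges to the supremum of its finite partial
    sums; all the other convergence statements are reduced to this one. *)
Lemma msum_norm f : msum (fun s => ((Normc.normc (f s)) ^+ 2)%:C%C) (nrm f ^+ 2)%:C%C.
Proof.
apply/cvgrPdist_lt => e e0.
have eE : e = (complex.Re e)%:C%C.
  by move: e0; case: e => a b; rewrite ltcE /= => /andP[/eqP -> _].
have e1 : 0 < complex.Re e by move: e0; rewrite eE ltcR.
have [X XP] := sum_norm_gt f e1.
exists X => // Y /= XY; rewrite partial_sumE -rmorph_sum -rmorphB eE normcE ltcR /=.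
rewrite expr0n addr0 sqrtr_sqr ger0_norm.
  rewrite ltrBlDr -ltrBlDl; exact: lt_le_trans XP (sum_norm_mono _ XY).
by rewrite subr_ge0 sum_norm_le.
Qed.

Lemma msumD u v y z : msum u y -> msum v z -> msum (fun s => u s + v s) (y + z).
Proof.
move=> hu hv; rewrite /msum.
have -> : psum ((fun s => u s + v s) : S -> R[i]^o) =
    (fun X => psum (u : S -> R[i]^o) X + psum (v : S -> R[i]^o) X).
  by apply/funext => X; rewrite !partial_sumE -big_split.
exact: cvgD hu hv.
Qed.

Lemma msumZ c u y : msum u y -> msum (fun s => c * u s) (c * y).
Proof.
move=> hu; rewrite /msum.
have -> : psum ((fun s => c * u s) : S -> R[i]^o) =
    (fun X => c *: psum (u : S -> R[i]^o) X).
  by apply/funext => X; rewrite !partial_sumE scaler_sumr.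
exact: cvgZl_tmp hu.
Qed.

Lemma msum_uniq u y z : msum u y -> msum u z -> y = z.
Proof.
move=> uy uz; rewrite -(cvg_lim (@norm_hausdorff _ _) uy).
exact: (cvg_lim (@norm_hausdorff _ _) uz).
Qed.

Lemma ell2D f g s : (f + g) s = f s + g s. Proof. by []. Qed.
Lemma ell2Z c f s : (c *: f) s = c * f s. Proof. by []. Qed.
Lemma ell2N f s : (- f) s = - f s. Proof. by []. Qed.

Lemma ell2_ext f g : f =1 g -> f = g.
Proof. by move=> fg; apply: val_inj; apply/funext. Qed.

Lemma polarization_pointwise (x y : R[i]) :
  x * y^*%C = 4%:R^-1 * (((Normc.normc (x + y)) ^+ 2)%:C%C
     + (-1) * ((Normc.normc (x + (-1) * y)) ^+ 2)%:C%C
     + 'i%C * ((Normc.normc (x + 'i%C * y)) ^+ 2)%:C%C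
     + (- 'i%C) * ((Normc.normc (x + (- 'i%C) * y)) ^+ 2)%:C%C).
Proof.
rewrite -!mul_conjc_normc; apply: (@mulfI _ 4%:R); first by rewrite pnatr_eq0.
rewrite mulVKf ?pnatr_eq0//.
case: x => a b; case: y => c d; simpc; apply/eqP; rewrite eq_complex /=.
by apply/andP; split; apply/eqP; ring.
Qed.

(** The right-hand side of the polarization identity. *)
Definition polar f g : R[i] := 4%:R^-1 * ((nrm (f + g) ^+ 2)%:C%C
     + (-1) * (nrm (f + (-1) *: g) ^+ 2)%:C%C
     + 'i%C * (nrm (f + 'i%C *: g) ^+ 2)%:C%C
     + (- 'i%C) * (nrm (f + (- 'i%C) *: g) ^+ 2)%:C%C).

(** Polarization writes the summand as a combination of four families of squares
    of moduli, so that the sum defining the inner product converges without any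
    appeal to the completeness of R[i]. *)
Lemma msum_polar f g : msum (fun s => f s * (g s)^*%C) (polar f g).
Proof.
under eq_fun do rewrite polarization_pointwise.
apply: msumZ; do 3 (apply: msumD; last by apply: msumZ; exact: msum_norm).
exact: msum_norm.
Qed.

Lemma inner_polar f g : inner f g = polar f g.
Proof. exact: (sum_cvg (@msum_polar f g)). Qed.

Lemma msum_inner f g : msum (fun s => f s * (g s)^*%C) (inner f g).
Proof. by rewrite inner_polar; exact: msum_polar. Qed.

Lemma innerDl f g h : inner (f + g) h = inner f h + inner g h.
Proof.
apply: msum_uniq (@msum_inner _ _) _.
under eq_fun do rewrite ell2D mulrDl.
exact: msumD (@msum_inner _ _) (@msum_inner _ _).
Qed.

Lemma innerZl c f g : inner (c *: f) g = c * inner f g.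
Proof.
apply: msum_uniq (@msum_inner _ _) _.
under eq_fun do rewrite ell2Z -mulrA.
exact: msumZ (@msum_inner f g).
Qed.

Lemma msum_conj u z : msum u z -> msum (fun s => (u s)^*%C) z^*%C.
Proof.
move=> /cvgrPdist_lt hu; apply/cvgrPdist_lt => e e0.
apply: filterS (hu e e0) => X; rewrite !partial_sumE -rmorph_sum -rmorphB.
by rewrite !normcE normc_conj.
Qed.

Lemma inner_conj f g : inner g f = (inner f g)^*%C.
Proof.
apply: msum_uniq (@msum_inner _ _) _.
have := msum_conj (@msum_inner f g); under eq_fun do rewrite rmorphM /= conjcK mulrC.
by [].
Qed.

Lemma inner_self f : inner f f = (nrm f ^+ 2)%:C%C.
Proof.
apply: msum_uniq (@msum_inner _ _) _.
under eq_fun do rewrite mul_conjc_normc.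
exact: msum_norm.
Qed.
End InnerProduct.

(** * Hilbert space geometry of l^2(S) *)

Section Hilbert.
Variables (R : realType) (S : choiceType).
Implicit Types (f g h : ell2 R S) (c z : R[i]).
Local Notation nrm := ell2_norm.

Lemma innerBl f g h : inner (f - g) h = inner f h - inner g h.
Proof. by rewrite -scaleN1r innerDl innerZl mulN1r. Qed.

Lemma innerDr f g h : inner f (g + h) = inner f g + inner f h.
Proof. by rewrite inner_conj innerDl rmorphD (inner_conj g f) (inner_conj h f). Qed.

Lemma innerZr c f g : inner f (c *: g) = c^*%C * inner f g.
Proof. by rewrite inner_conj innerZl rmorphM (inner_conj g f). Qed.

Lemma innerBr f g h : inner f (g - h) = inner f g - inner f h.
Proof. by rewrite inner_conj innerBl rmorphB (inner_conj g f) (inner_conj h f). Qed.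

Lemma inner0l f : inner 0 f = 0.
Proof. by rewrite -(scale0r 0) innerZl mul0r. Qed.

Lemma inner0r f : inner f 0 = 0.
Proof. by rewrite inner_conj inner0l rmorph0. Qed.

Lemma realC_inj (x y : R) : x%:C%C = y%:C%C -> x = y.
Proof. by case. Qed.

Lemma realCM (x y : R) : (x * y)%:C%C = x%:C%C * y%:C%C.
Proof. exact: rmorphM. Qed.

Lemma realCB (x y : R) : (x - y)%:C%C = x%:C%C - y%:C%C.
Proof. exact: rmorphB. Qed.

Lemma realCD (x y : R) : (x + y)%:C%C = x%:C%C + y%:C%C.
Proof. exact: rmorphD. Qed.

Lemma normc_ge0 z : 0 <= Normc.normc z.
Proof. by case: z => a b; exact: sqrtr_ge0. Qed.

Lemma ell2_normZ c f : nrm (c *: f) = Normc.normc c * nrm f.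
Proof.
apply: (@pexpIrn _ 2) => //; rewrite ?nnegrE ?mulr_ge0 ?normc_ge0 ?ell2_norm_ge0//.
apply: realC_inj; rewrite -inner_self innerZl innerZr mulrA mul_conjc_normc.
by rewrite inner_self exprMn [RHS]realCM.
Qed.

Lemma normc_opp z : Normc.normc (- z) = Normc.normc z.
Proof. by case: z => a b; rewrite /= !sqrrN. Qed.

Lemma ell2_normN f : nrm (- f) = nrm f.
Proof. by rewrite -scaleN1r ell2_normZ normc_opp Normc.normc1 mul1r. Qed.

Lemma ell2_norm0 : nrm (0 : ell2 R S) = 0.
Proof. by rewrite -(scale0r 0) ell2_normZ Normc.normc0 mul0r. Qed.

Lemma ell2_coord_le f s : Normc.normc (f s) <= nrm f.
Proof.
rewrite -(@ler_pXn2r _ 2)// ?nnegrE ?normc_ge0 ?ell2_norm_ge0//.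
by apply: le_trans (sum_norm_le f [fset s]%fset); rewrite big_seq_fset1.
Qed.

Lemma ell2_norm_eq0 f : nrm f = 0 -> f = 0.
Proof.
move=> f0; apply: ell2_ext => s; apply: Normc.eq0_normc.
by apply/eqP; rewrite eq_le normc_ge0 -f0 ell2_coord_le.
Qed.

(** Expand the square of the norm of ||g||^2 f - <f, g> g. *)
Lemma ell2_cauchy_schwarz f g : Normc.normc (inner f g) <= nrm f * nrm g.
Proof.
have [/eqP/ell2_norm_eq0 ->|g0] := boolP (nrm g == 0).
  by rewrite inner0r Normc.normc0 mulr_ge0// ell2_norm_ge0.
have gp : 0 < nrm g by rewrite lt_neqAle eq_sym g0 ell2_norm_ge0.
rewrite -(@ler_pXn2r _ 2)// ?nnegrE ?mulr_ge0 ?normc_ge0 ?ell2_norm_ge0//.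
rewrite exprMn; set z := inner f g.
have : 0 <= nrm ((nrm g ^+ 2)%:C%C *: f - z *: g) ^+ 2 by exact: sqr_ge0.
suff -> : nrm ((nrm g ^+ 2)%:C%C *: f - z *: g) ^+ 2 =
    nrm g ^+ 2 * (nrm f ^+ 2 * nrm g ^+ 2 - Normc.normc z ^+ 2).
  by rewrite pmulr_rge0 ?subr_ge0// exprn_gt0.
apply: realC_inj; rewrite -inner_self.
rewrite innerBl !innerBr !innerZl !innerZr (inner_conj f g) -/z !inner_self.
rewrite [RHS]realCM realCB (realCM (nrm f ^+ 2)) -mul_conjc_normc.
rewrite [(_%:C)^*%C]conjc_real; ring.
Qed.

Lemma Re_norm_le z : `|complex.Re z| <= Normc.normc z.
Proof.
by case: z => a b /=; rewrite -sqrtr_sqr ler_wsqrtr// lerDl sqr_ge0.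
Qed.

Lemma Re_le_normc z : complex.Re z <= Normc.normc z.
Proof. exact: le_trans (ler_norm _) (Re_norm_le z). Qed.

Lemma ell2_normD_sqr f g :
  nrm (f + g) ^+ 2 = nrm f ^+ 2 + nrm g ^+ 2 + complex.Re (inner f g) *+ 2.
Proof.
apply: realC_inj; rewrite -inner_self innerDl !innerDr !inner_self (inner_conj f g).
case: (inner f g) => a b; rewrite !realCD.
by simpc; apply/eqP; rewrite eq_complex /=; apply/andP; split; apply/eqP; ring.
Qed.

Lemma ell2_normD f g : nrm (f + g) <= nrm f + nrm g.
Proof.
rewrite -(@ler_pXn2r _ 2)// ?nnegrE ?addr_ge0 ?ell2_norm_ge0//.
rewrite ell2_normD_sqr sqrrD addrAC lerD2r lerD2l lerMn2r /=.
exact: le_trans (Re_le_normc _) (ell2_cauchy_schwarz _ _).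
Qed.

Lemma ell2_normB f g : nrm (f - g) <= nrm f + nrm g.
Proof. by rewrite -(ell2_normN g); exact: ell2_normD. Qed.

Lemma ell2_distC f g : nrm (f - g) = nrm (g - f).
Proof. by rewrite -ell2_normN opprB. Qed.

Lemma ell2_norm_sum I (r : seq I) (P : pred I) (F : I -> ell2 R S) :
  nrm (\sum_(i <- r | P i) F i) <= \sum_(i <- r | P i) nrm (F i).
Proof.
elim/big_ind2 : _ => [|x1 x2 y1 y2 h1 h2|//]; first by rewrite ell2_norm0.
by apply: le_trans (ell2_normD _ _) _; exact: lerD.
Qed.

(** The means of constructing vectors of l^2(S): only finite sums are estimated. *)
Lemma square_summable_bound (u : S -> R[i]^o) (M : R) :
  (forall X : {fset S}, \sum_(s <- X) Normc.normc (u s) ^+ 2 <= M) ->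
  exists f : ell2 R S, f =1 u /\ nrm f ^+ 2 <= M.
Proof.
move=> uM.
have H : (\esum_(s in [set: S]) ((Normc.normc (u s)) ^+ 2)%:E <= M%:E)%E.
  apply: ge_ereal_sup => _ [A [finA _] <-].
  by rewrite -(fset_setK finA) fsbig_fset lee_fin.
have uS : u \in square_summable (R := R) (S := S).
  by apply/asboolP; exact: le_lt_trans H (ltry _).
by exists (Ell2 uS); split => //; rewrite -lee_fin ell2_norm_sqr.
Qed.

Lemma ell2_norm_le f (M : R) :
  (forall X : {fset S}, \sum_(s <- X) Normc.normc (f s) ^+ 2 <= M) ->
  nrm f ^+ 2 <= M.
Proof.
by move=> /square_summable_bound[g [gf]]; rewrite (ell2_ext gf).
Qed.

Lemma ell2_delta_subproof (t : S) :
  exists f : ell2 R S, forall s, f s = (s == t)%:R.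
Proof.
have [|f [fE _]] := @square_summable_bound (fun s => (s == t)%:R) 1; last by exists f.
move=> X; have [tX|tX] := boolP (t \in X).
  rewrite (big_fsetD1 t)//= eqxx Normc.normc1 expr1n big_seq big1 ?addr0// => s.
  by rewrite !inE => /andP[/negbTE -> _]; rewrite Normc.normc0 expr0n.
rewrite big_seq big1 ?ler01// => s sX.
have /negbTE -> : s != t by apply: contraNneq tX => <-.
by rewrite Normc.normc0 expr0n.
Qed.

Definition delta (t : S) : ell2 R S := projT1 (cid (ell2_delta_subproof t)).

Lemma deltaE t s : delta t s = (s == t)%:R.
Proof. by rewrite /delta; case: cid. Qed.

Lemma inner_delta f t : inner f (delta t) = f t.
Proof.
apply: (@sum_cvg S _ R[i]^o).
apply/cvgrPdist_lt => e e0; exists [fset t]%fset => // Y /= tY.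
rewrite partial_sumE (big_fsetD1 t) /=; last by apply: (fsubsetP tY); rewrite inE.
rewrite deltaE eqxx conjc1 mulr1 big_seq big1 ?addr0 ?subrr ?normr0// => s.
by rewrite !inE deltaE => /andP[/negbTE -> _]; rewrite conjc0 mulr0.
Qed.

Lemma ell2_norm_delta t : nrm (delta t) = 1.
Proof.
apply: (@pexpIrn _ 2) => //; rewrite ?nnegrE ?ell2_norm_ge0//.
by apply: realC_inj; rewrite -inner_self inner_delta deltaE eqxx expr1n.
Qed.

(** The truncation g of f to X has <f, g> = <g, g>, so ||f - g||^2 is the tail of
    the sum of squares. *)
Lemma finite_support_dense f (e : R) : 0 < e -> exists X : {fset S},
  nrm (f - \sum_(s <- X) f s *: delta s) < e.
Proof.
move=> e0; have [X XP] := sum_norm_gt f (exprn_gt0 2 e0).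
exists X; set g := \sum_(s <- X) _.
have fg : inner f g = (\sum_(s <- X) Normc.normc (f s) ^+ 2)%:C%C.
  rewrite /g; elim/big_rec2 : _ => [|s x y _ IH]; first by rewrite inner0r.
  by rewrite innerDr innerZr inner_delta realCD IH mulrC mul_conjc_normc.
have gE s : s \in X -> g s = f s.
  move=> sX; rewrite -inner_delta /g (big_fsetD1 s)//= innerDl innerZl.
  rewrite inner_delta deltaE eqxx mulr1 -[RHS]addr0; congr (_ + _).
  rewrite big_seq; elim/big_rec : _ => [|t x]; first by rewrite inner0l.
  rewrite !inE => /andP[ts _] x0; rewrite innerDl innerZl inner_delta deltaE.
  by rewrite eq_sym (negbTE ts) mulr0 x0 addr0.
have gg : inner g g = (\sum_(s <- X) Normc.normc (f s) ^+ 2)%:C%C.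
  rewrite {2}/g; rewrite big_seq [in RHS]big_seq.
  elim/big_rec2 : _ => [|s x y sX IH]; first by rewrite inner0r.
  by rewrite innerDr innerZr inner_delta realCD IH gE// mulrC mul_conjc_normc.
rewrite -(@ltr_pXn2r _ 2)// ?nnegrE ?ell2_norm_ge0 ?(ltW e0)//.
suff -> : nrm (f - g) ^+ 2 = nrm f ^+ 2 - \sum_(s <- X) Normc.normc (f s) ^+ 2.
  by rewrite ltrBlDr addrC -ltrBlDr.
apply: realC_inj; rewrite -inner_self innerBl !innerBr (inner_conj f g) fg gg.
by rewrite inner_self [(_%:C)^*%C]conjc_real realCB subrr subr0.
Qed.
End Hilbert.

(** * Completeness, and multiplication by functions *)

Section Complete.
Variables (R : realType) (S : choiceType).
Implicit Types (f g h : ell2 R S) (c z : R[i]).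
Local Notation nrm := ell2_norm.

Lemma real_cauchy_lim (u : nat -> R) :
  (forall e : R, 0 < e -> exists N, forall n m, (N <= n)%N -> (N <= m)%N ->
     `|u n - u m| <= e) -> exists l : R, u @ \oo --> l.
Proof.
move=> cu; exists (lim (u @ \oo) : R); apply: cauchy_cvg.
apply/cauchy_exP => e e0; have [N NP] := cu (e / 2) (divr_gt0 e0 (ltr0Sn _ 1)).
exists (u N); exists N => // n /= Nn; rewrite /ball/=.
apply: le_lt_trans (NP N n (leqnn _) Nn) _.
by rewrite ltr_pdivrMr// ltr_pMr// ltr1n.
Qed.

Lemma cvg_finite_sum (I : Type) (r : seq I) (u : I -> nat -> R) (l : I -> R) :
  (forall i, u i @ \oo --> l i) ->
  (fun n => \sum_(i <- r) u i n) @ \oo --> \sum_(i <- r) l i.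
Proof.
move=> ul; elim: r => [|i r IH].
  by rewrite big_nil; under eq_fun do rewrite big_nil; exact: cvg_cst.
by rewrite big_cons; under eq_fun do rewrite big_cons; exact: cvgD.
Qed.

Lemma normc_sqr z : Normc.normc z ^+ 2 = (complex.Re z) ^+ 2 + (complex.Im z) ^+ 2.
Proof. by case: z => a b /=; rewrite sqr_sqrtr// addr_ge0// sqr_ge0. Qed.

Lemma Im_norm_le z : `|complex.Im z| <= Normc.normc z.
Proof.
by case: z => a b /=; rewrite -sqrtr_sqr ler_wsqrtr// lerDr sqr_ge0.
Qed.

Lemma normcD_sqr_le (x y : R[i]) :
  Normc.normc (x + y) ^+ 2 <= (Normc.normc x ^+ 2 + Normc.normc y ^+ 2) *+ 2.
Proof.
rewrite !normc_sqr; case: x => a b; case: y => c d /=; rewrite -subr_ge0.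
suff -> : (a ^+ 2 + b ^+ 2 + (c ^+ 2 + d ^+ 2)) *+ 2 -
    ((a + c) ^+ 2 + (b + d) ^+ 2) = (a - c) ^+ 2 + (b - d) ^+ 2.
  by rewrite addr_ge0// sqr_ge0.
ring.
Qed.

(** The coordinates converge to some u. On a fixed finite set of coordinates this
    convergence is uniform, so the Cauchy bound for F n - F m passes to F n - u
    there, with a factor 2; the bound is then independent of the finite set. *)
Lemma ell2_complete (F : nat -> ell2 R S) :
  (forall e : R, 0 < e -> exists N, forall n m, (N <= n)%N -> (N <= m)%N ->
     nrm (F n - F m) <= e) ->
  exists f, forall e : R, 0 < e -> exists N, forall n, (N <= n)%N -> nrm (F n - f) <= e.
Proof.
move=> cF.
have cvRe s : exists l : R, (fun n => complex.Re (F n s)) @ \oo --> l.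
  apply: real_cauchy_lim => e e0; have [N NP] := cF e e0; exists N => n m Nn Nm.
  apply: le_trans (NP n m Nn Nm); apply: le_trans (ell2_coord_le _ s).
  by apply: le_trans (Re_norm_le _); rewrite ell2D ell2N raddfB.
have cvIm s : exists l : R, (fun n => complex.Im (F n s)) @ \oo --> l.
  apply: real_cauchy_lim => e e0; have [N NP] := cF e e0; exists N => n m Nn Nm.
  apply: le_trans (NP n m Nn Nm); apply: le_trans (ell2_coord_le _ s).
  by apply: le_trans (Im_norm_le _); rewrite ell2D ell2N raddfB.
have [lr lrP] := choice cvRe; have [li liP] := choice cvIm.
pose u s : R[i]^o := (lr s +i* li s)%C.
have uP (X : {fset S}) (e : R) : 0 < e -> \forall m \near \oo,
    \sum_(s <- X) Normc.normc (F m s - u s) ^+ 2 <= e.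
  move=> e0.
  have : (fun m => \sum_(s <- X) Normc.normc (F m s - u s) ^+ 2) @ \oo -->
      \sum_(s <- X) ((lr s - lr s) * (lr s - lr s) + (li s - li s) * (li s - li s)).
    apply: cvg_finite_sum => s.
    under eq_fun do rewrite normc_sqr !expr2 !raddfB /=.
    by apply: cvgD; apply: cvgM; apply: cvgB => //; exact: cvg_cst.
  rewrite big1 => [|s _]; last by rewrite !subrr mulr0 addr0.
  move=> /cvgrPdist_lt /(_ e e0); apply: filterS => m; rewrite sub0r normrN.
  by move=> /ltW; apply: le_trans; exact: ler_norm.
have bnd n N (e : R) (X : {fset S}) : 0 < e -> (forall m, (N <= m)%N ->
  nrm (F n - F m) <= e) ->
    \sum_(s <- X) Normc.normc (F n s - u s) ^+ 2 <= (2 * e) ^+ 2.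
  move=> e0 He; have [M _ MP] := uP X (e ^+ 2) (exprn_gt0 2 e0).
  pose m := maxn M N.
  apply: (@le_trans _ _ (\sum_(s <- X) (Normc.normc ((F n - F m) s) ^+ 2 +
      Normc.normc (F m s - u s) ^+ 2) *+ 2)).
    apply: ler_sum => s _; apply: le_trans (normcD_sqr_le _ _).
    by rewrite ell2D ell2N addrA subrK.
  rewrite sumrMnl big_split /=.
  have h1 := MP m (leq_maxl _ _).
  have h2 : \sum_(s <- X) Normc.normc ((F n - F m) s) ^+ 2 <= e ^+ 2.
    apply: le_trans (sum_norm_le _ _) _.
    by rewrite ler_pXn2r ?nnegrE ?ell2_norm_ge0 ?(ltW e0)// He// leq_maxr.
  rewrite /= in h1; rewrite exprMn; lra.
have [N0 N0P] := cF 1 ltr01.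
have [g [gE _]] : exists g : ell2 R S, g =1 (fun s =>
  F N0 s - u s) /\ nrm g ^+ 2 <= (2 * 1) ^+ 2.
  apply: square_summable_bound => X; apply: (bnd N0 N0) => // m Nm; exact: N0P.
exists (F N0 - g) => e e0.
have [N NP] := cF (e / 2) (divr_gt0 e0 (ltr0Sn _ 1)); exists N => n Nn.
rewrite -(@ler_pXn2r _ 2)// ?nnegrE ?ell2_norm_ge0 ?(ltW e0)//.
apply: ell2_norm_le => X.
rewrite (_ : e ^+ 2 = (2 * (e / 2)) ^+ 2); last by congr (_ ^+ 2); lra.
under eq_bigr do rewrite !(ell2D, ell2N) gE subKr.
by apply: (bnd n N) => [|m Nm]; [rewrite divr_gt0|exact: NP].
Qed.

Lemma conjc_realM (x : R) z : (x%:C%C * z)^*%C = x%:C%C * z^*%C.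
Proof. by case: z => a b; simpc. Qed.

Lemma inner_pointwise f g f' g' :
  (forall s, f s * (g s)^*%C = f' s * (g' s)^*%C) -> inner f g = inner f' g'.
Proof.
move=> /funext e; apply: msum_uniq (@msum_inner _ _ f g) _.
by rewrite e; exact: msum_inner.
Qed.

(** A relation rather than an operator, since m f is square summable only under a
    hypothesis on m; for bounded m it is provided by [multiplied_ex]. *)
Definition multiplied (m : S -> R) f h := forall s, h s = (m s)%:C%C * f s.

Lemma normc_real (x : R) : Normc.normc x%:C%C = `|x|.
Proof. by rewrite /= expr0n addr0 sqrtr_sqr. Qed.

Lemma multiplied_ex (m : S -> R) (M : R) f : (forall s, 0 <= m s <= M) ->
  exists h, multiplied m f h /\ nrm h <= M * nrm f.
Proof.
move=> mM.
have [X|h [hE hM]] := @square_summable_bound R S (fun s =>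
  (m s)%:C%C * f s) ((M * nrm f) ^+ 2).
  apply: (@le_trans _ _ (\sum_(s <- X) M ^+ 2 * Normc.normc (f s) ^+ 2)).
    apply: ler_sum => s _; rewrite Normc.normcM exprMn ler_wpM2r ?sqr_ge0//.
    have /andP[m0 m1] := mM s; rewrite normc_real ger0_norm// ler_pXn2r ?nnegrE//.
    exact: le_trans m0 m1.
  by rewrite -mulr_sumr exprMn ler_wpM2l ?sqr_ge0// sum_norm_le.
exists h; split => //.
have [[s0 _]|noS] := pselect (exists s : S, True); last first.
  have -> : h = 0 by apply: ell2_ext => s; case: noS; exists s.
  have -> : f = 0 by apply: ell2_ext => s; case: noS; exists s.
  by rewrite ell2_norm0 mulr0.
have M0 : 0 <= M by have /andP[] := mM s0; exact: le_trans.
rewrite -(@ler_pXn2r _ 2)// ?nnegrE ?mulr_ge0 ?ell2_norm_ge0//.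
Qed.

(** For 0 <= m <= 1, <m f, f> - <m f, m f> is the square of the norm of
    sqrt (m (1 - m)) f. *)
Lemma multiplied_norm (m : S -> R) f h : (forall s, 0 <= m s <= 1) ->
  multiplied m f h -> nrm h ^+ 2 <= complex.Re (inner h f).
Proof.
move=> m01 hE.
have [s|k [kE _]] := @multiplied_ex (fun s => Num.sqrt (m s * (1 - m s))) 1 f.
  rewrite sqrtr_ge0 -[leRHS]sqrtr1 ler_wsqrtr//; have /andP[m0 m1] := m01 s; nra.
have : inner h (f - h) = inner k k.
  apply: inner_pointwise => s; rewrite hE kE ell2D ell2N hE.
  have /andP[m0 m1] := m01 s; have mm : 0 <= m s * (1 - m s) by rewrite mulr_ge0//
    subr_ge0.
  set x := f s; rewrite conjc_realM mulrACA -realCM -expr2 sqr_sqrtr//.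
  rewrite -[x in x - _]mul1r -mulrBl -realCB conjc_realM.
  by rewrite mulrACA -realCM.
rewrite innerBr !inner_self => /(congr1 (@complex.Re R)); rewrite raddfB /= => e.
by rewrite -subr_ge0 e sqr_ge0.
Qed.

Lemma multiplied_adj (m : S -> R) f h f' h' :
  multiplied m f h -> multiplied m f' h' -> inner h f' = inner f h'.
Proof.
move=> hE hE'; apply: inner_pointwise => s; rewrite hE hE' conjc_realM.
by rewrite -mulrA mulrCA.
Qed.

Lemma jensen_sqr n (t x : 'I_n -> R) : (forall i, 0 <= t i) -> \sum_i t i = 1 ->
  (\sum_i t i * x i) ^+ 2 <= \sum_i t i * x i ^+ 2.
Proof.
move=> t0 t1; set y := \sum_i t i * x i.
have : 0 <= \sum_i t i * (x i - y) ^+ 2.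
  by apply: sumr_ge0 => i _; rewrite mulr_ge0// sqr_ge0.
rewrite (eq_bigr (fun i => t i * x i ^+ 2 - (t i * x i * (2 * y) - t i * y ^+ 2)));
  last first.
  by move=> i _; ring.
rewrite !sumrB -!mulr_suml t1 -/y; lra.
Qed.

(** By convexity of the square and [multiplied_norm], the square of the left-hand
    side is at most <w f, f>, where w, the average of the u i, is at most e. *)
Lemma average_multiplied n (t : 'I_n -> R) (u : 'I_n -> S -> R) (e : R) f
    (h : 'I_n -> ell2 R S) :
  (forall i, 0 <= t i) -> \sum_i t i = 1 -> (forall i s, 0 <= u i s <= 1) -> 0 <= e ->
  (forall s, \sum_i t i * u i s <= e) -> (forall i, multiplied (u i) f (h i)) ->
  \sum_i t i * nrm (h i) <= Num.sqrt e * nrm f.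
Proof.
move=> t0 t1 u01 e0 ue hE.
rewrite -(@ler_pXn2r _ 2)// ?nnegrE ?mulr_ge0 ?sqrtr_ge0 ?ell2_norm_ge0//; last first.
  by apply: sumr_ge0 => i _; rewrite mulr_ge0// ell2_norm_ge0.
apply: le_trans (jensen_sqr _ t0 t1) _; rewrite exprMn sqr_sqrtr//.
pose w s := \sum_i t i * u i s.
have [s|k [kE kn]] := @multiplied_ex w e f.
  by rewrite ue andbT; apply: sumr_ge0 => i _; rewrite mulr_ge0//; case/andP: (u01 i s).
have kS : k = \sum_i (t i)%:C%C *: h i.
  apply: ell2_ext => s; rewrite -(inner_delta (\sum_i _)).
  have -> : inner (\sum_i (t i)%:C%C *: h i) (delta R s) = \sum_i (t i)%:C%C * h i s.
    elim/big_rec2 : _ => [|i x y _ IH]; first by rewrite inner0l.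
    by rewrite innerDl innerZl inner_delta IH.
  rewrite kE rmorph_sum mulr_suml; apply: eq_bigr => i _.
  by rewrite hE mulrA -realCM.
apply: (@le_trans _ _ (complex.Re (inner k f))).
  rewrite kS.
  have -> : inner (\sum_i (t i)%:C%C *: h i) f = \sum_i (t i)%:C%C * inner (h i) f.
    elim/big_rec2 : _ => [|i x y _ IH]; first by rewrite inner0l.
    by rewrite innerDl innerZl IH.
  rewrite raddf_sum; apply: ler_sum => i _ /=.
  apply: (@le_trans _ _ (t i * complex.Re (inner (h i) f))).
    by rewrite ler_wpM2l//; exact: multiplied_norm (hE i).
  by case: (inner (h i) f) => a b /=; rewrite mul0r subr0.
apply: le_trans (Re_le_normc _) _; apply: le_trans (ell2_cauchy_schwarz _ _) _.
by rewrite expr2 mulrA ler_wpM2r// ell2_norm_ge0.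
Qed.
End Complete.

(** * Bounded operators *)

Section Operators.
Variables (R : realType).
Local Notation nrm := ell2_norm.

Definition bounded_by (S S' : choiceType) (M : R) (T : ell2 R S -> ell2 R S') : Prop :=
  forall x, nrm (T x) <= M * nrm x.

Section OneSpace.
Variable (S : choiceType).
Implicit Types (x y : ell2 R S) (T U : operator R S).

Lemma operatorD T U x : (T + U) x = T x + U x. Proof. by []. Qed.
Lemma operatorB T U x : (T - U) x = T x - U x. Proof. by []. Qed.
Lemma operatorZ c T x : (c *: T) x = c *: T x. Proof. by []. Qed.

Lemma linear_op0 T : linear T -> T 0 = 0.
Proof. by move=> h; have := h (-1) 0 0; rewrite scaler0 addr0 scaleN1r addNr. Qed.

Lemma linear_opD T x y : linear T -> T (x + y) = T x + T y.
Proof. by move=> h; have := h 1 x y; rewrite !scale1r. Qed.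

Lemma linear_opZ T c x : linear T -> T (c *: x) = c *: T x.
Proof. by move=> h; have := h c x 0; rewrite (linear_op0 h) !addr0. Qed.

Lemma linear_opB T x y : linear T -> T (x - y) = T x - T y.
Proof. by move=> h; rewrite (linear_opD _ _ h) -scaleN1r (linear_opZ _ _ h) scaleN1r.
  Qed.

Lemma linear_opsum T I (r : seq I) (F : I -> ell2 R S) : linear T ->
  T (\sum_(i <- r) F i) = \sum_(i <- r) T (F i).
Proof.
move=> h; elim: r => [|i r IH]; first by rewrite !big_nil (linear_op0 h).
by rewrite !big_cons (linear_opD _ _ h) IH.
Qed.

Lemma bounded_by_le M N T : M <= N -> bounded_by M T -> bounded_by N T.
Proof. by move=> MN h x; apply: le_trans (h x) _; rewrite ler_wpM2r ?ell2_norm_ge0. Qed.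

Lemma bounded_byD M N T U : bounded_by M T -> bounded_by N U ->
  bounded_by (M + N) (T + U).
Proof.
by move=> hT hU x; apply: le_trans (ell2_normD _ _) _; rewrite mulrDl; exact: lerD.
Qed.

Lemma bounded_byB M N T U : bounded_by M T -> bounded_by N U ->
  bounded_by (M + N) (T - U).
Proof.
by move=> hT hU x; apply: le_trans (ell2_normB _ _) _; rewrite mulrDl; exact: lerD.
Qed.

Lemma bounded_byZ M c T : bounded_by M T -> bounded_by (Normc.normc c * M) (c *: T).
Proof.
by move=> hT x; rewrite ell2_normZ -mulrA ler_wpM2l ?normc_ge0.
Qed.

Lemma bounded_byM M N T U : 0 <= M -> bounded_by M T -> bounded_by N U ->
  bounded_by (M * N) (T \o U).
Proof.
by move=> M0 hT hU x; apply: le_trans (hT _) _; rewrite -mulrA ler_wpM2l.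
Qed.

Lemma bounded_by_distC M T U : bounded_by M (T - U) -> bounded_by M (U - T).
Proof. by move=> h x; have := h x; rewrite [nrm ((T - U) x)]ell2_distC. Qed.

Lemma bounded_by_dist3 M N T U V :
  bounded_by M (T - U) -> bounded_by N (U - V) -> bounded_by (M + N) (T - V).
Proof. by move=> h k; have := bounded_byD h k; rewrite addrA subrK. Qed.

Lemma bounded_by_eq0 T : (forall e : R, 0 < e -> bounded_by e T) -> T = 0.
Proof.
move=> h; apply/funext => x; apply: ell2_norm_eq0; apply/eqP;
  rewrite eq_le ell2_norm_ge0 andbT.
apply/ler_addgt0Pl => e e0; rewrite addr0.
have x1 : 0 < nrm x + 1 by rewrite ltr_wpDl// ell2_norm_ge0.
apply: le_trans (h (e / (nrm x + 1)) _ x) _; first by rewrite divr_gt0.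
by rewrite -mulrA ler_piMr ?(ltW e0)// mulrC ler_pdivrMr// mul1r lerDl.
Qed.

Lemma bounded_operatorP (T : operator R S) :
  bounded_operator T -> linear T /\ exists M, 0 < M /\ bounded_by M T.
Proof.
move=> [lT [M hM]]; split => //; exists (Num.max M 1).
by rewrite lt_max ltr01 orbT; split => //; apply: bounded_by_le hM; rewrite le_max lexx.
Qed.

Lemma bounded_operator_linear c T U : bounded_operator T -> bounded_operator U ->
  bounded_operator (c *: T + U).
Proof.
move=> [lT [M hM]] [lU [N hN]]; split.
  move=> d x y.
  rewrite [LHS](_ : _ = c *: T (d *: x + y) + U (d *: x + y))// lT lU.
  rewrite [RHS](_ : _ = d *: (c *: T x + U x) + (c *: T y + U y))//.
  by rewrite !scalerDr !scalerA [d * c]mulrC addrACA.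
by exists (Normc.normc c * M + N); apply: bounded_byD hN; exact: bounded_byZ.
Qed.

Lemma bounded_operatorB T U : bounded_operator T -> bounded_operator U ->
  bounded_operator (T - U).
Proof.
by move=> hT hU; rewrite addrC -scaleN1r; exact: bounded_operator_linear.
Qed.

Lemma bounded_operatorM T U : bounded_operator T -> bounded_operator U ->
  bounded_operator (T \o U).
Proof.
move=> /bounded_operatorP[lT [M [M0 hM]]] [lU [N hN]]; split.
  by move=> d x y /=; rewrite lU lT.
by exists (M * N); apply: bounded_byM => //; exact: ltW.
Qed.

Lemma bounded_by_opnorm T : bounded_operator T -> bounded_by (opnorm T) T.
Proof.
move=> /bounded_operatorP[lT [M [M0 hM]]] x.
have hs : has_sup [set nrm (T x) | x in [set x | nrm x <= 1]].
  split; first by exists (nrm (T 0)); exists 0 => //=; rewrite ell2_norm0.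
  exists M => _ [y /= y1 <-]; apply: le_trans (hM y) _.
  by rewrite ler_piMr// ltW.
have [/eqP/ell2_norm_eq0 ->|x0] := boolP (nrm x == 0).
  by rewrite (linear_op0 lT) ell2_norm0 mulr0.
have xp : 0 < nrm x by rewrite lt_neqAle eq_sym x0 ell2_norm_ge0.
rewrite -ler_pdivrMr// mulrC.
have -> : (nrm x)^-1 * nrm (T x) = nrm (T (((nrm x)^-1)%:C%C *: x)).
  by rewrite (linear_opZ _ _ lT) ell2_normZ normc_real ger0_norm// invr_ge0 ltW.
apply: ub_le_sup; first by case: hs.
exists (((nrm x)^-1)%:C%C *: x) => //=.
by rewrite ell2_normZ normc_real ger0_norm ?invr_ge0 ?(ltW xp)// mulVf.
Qed.

Lemma opnorm_le M T : 0 <= M -> bounded_by M T -> opnorm T <= M.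
Proof.
move=> M0 hT; apply: ge_sup; first by exists (nrm (T 0)); exists 0 => //=;
  rewrite ell2_norm0.
by move=> _ [y /= y1 <-]; apply: le_trans (hT y) _; rewrite ler_piMr.
Qed.

(** [opnorm] is a supremum, which controls the operator only when it is bounded;
    [bounded_by] states the same approximation without suprema. *)
Lemma norm_closureP (E : set (operator R S)) T : E `<=` @bounded_operator R S ->
  norm_closure E T <->
  (bounded_operator T /\ forall e : R, 0 < e -> exists2 U, E U & bounded_by e (T - U)).
Proof.
move=> Eb; split=> -[bT h]; split => // e e0.
  have [U EU hU] := h e e0; exists U => //.
  by apply: bounded_by_le (ltW hU) _; apply: bounded_by_opnorm;
    apply: bounded_operatorB => //; exact: Eb.
have e2 : 0 < e / 2 by rewrite divr_gt0.
have [U EU hU] := h (e / 2) e2; exists U => //.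
by apply: le_lt_trans (opnorm_le (ltW e2) hU) _; rewrite ltr_pdivrMr// ltr_pMr// ltr1n.
Qed.

(** ||U y||^2 = <T (U y), y> <= M ||U y|| ||y||. *)
Lemma bounded_by_adjoint M T U :
  0 <= M -> is_adjoint T U -> bounded_by M T -> bounded_by M U.
Proof.
move=> M0 adj hT y.
have [/eqP ->|u0] := boolP (nrm (U y) == 0); first by rewrite mulr_ge0// ell2_norm_ge0.
have up : 0 < nrm (U y) by rewrite lt_neqAle eq_sym u0 ell2_norm_ge0.
rewrite -(ler_pM2l up) -expr2.
have -> : nrm (U y) ^+ 2 = Normc.normc (inner (T (U y)) y).
  by rewrite adj inner_self normc_real ger0_norm// sqr_ge0.
apply: le_trans (ell2_cauchy_schwarz _ _) _; rewrite mulrA ler_wpM2r ?ell2_norm_ge0//.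
by rewrite [_ * M]mulrC.
Qed.

Lemma operator_complete (F : nat -> operator R S) :
  (forall n, bounded_operator (F n)) ->
  (forall e : R, 0 < e -> exists N, forall n m, (N <= n)%N -> (N <= m)%N ->
     bounded_by e (F n - F m)) ->
  exists T, bounded_operator T /\
    forall e : R, 0 < e -> exists N, forall n, (N <= n)%N -> bounded_by e (F n - T).
Proof.
move=> bF cF.
have cv x : exists y, forall e : R, 0 < e -> exists N, forall n, (N <= n)%N ->
  nrm (F n x - y) <= e.
  apply: ell2_complete => e e0.
  have x1 : 0 < nrm x + 1 by rewrite ltr_wpDl// ell2_norm_ge0.
  have [N NP] := cF (e / (nrm x + 1)) (divr_gt0 e0 x1).
  exists N => n m Nn Nm; apply: le_trans (NP n m Nn Nm x) _.
  by rewrite -mulrA ler_piMr ?(ltW e0)// mulrC ler_pdivrMr// mul1r lerDl.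
have [T TP] := choice cv.
have TF (e : R) : 0 < e -> exists N, forall n, (N <= n)%N -> bounded_by e (F n - T).
  move=> e0; have [N NP] := cF e e0; exists N => n Nn x.
  apply/ler_addgt0Pr => d d0; have [N' N'P] := TP x d d0.
  pose m := maxn N N'.
  have -> : (F n - T) x = (F n - F m) x + (F m x - T x).
    by rewrite !operatorB addrA subrK.
  apply: le_trans (ell2_normD _ _) _; apply: lerD; first by apply: NP => //;
    exact: leq_maxl.
  by apply: N'P; exact: leq_maxr.
exists T; split => //; split.
  move=> c x y; apply/eqP; rewrite -subr_eq0; apply/eqP; apply: ell2_norm_eq0.
  apply/eqP; rewrite eq_le ell2_norm_ge0 andbT; apply/ler_addgt0Pl => e e0;
    rewrite addr0.
  pose K := nrm (c *: x + y) + (Normc.normc c * nrm x + nrm y) + 1.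
  have K0 : 0 < K by rewrite ltr_wpDl// !addr_ge0// ?mulr_ge0 ?ell2_norm_ge0 ?normc_ge0.
  have [N NP] := TF (e / K) (divr_gt0 e0 K0).
  have [lF _] := bF N; have hN := NP N (leqnn N).
  have -> : T (c *: x + y) - (c *: T x + T y) =
      c *: (F N - T) x + (F N - T) y - (F N - T) (c *: x + y).
    rewrite !operatorB lF; apply: ell2_ext => s; rewrite !(ell2D, ell2N, ell2Z); ring.
  apply: le_trans (ell2_normB _ _) _; apply: le_trans (lerD (ell2_normD _ _) (lexx
    _)) _.
  rewrite ell2_normZ.
  apply: (@le_trans _ _ (e / K * (Normc.normc c * nrm x + nrm y + nrm (c *: x + y)))).
    rewrite !mulrDr; apply: lerD (hN _); apply: lerD (hN _).
    by rewrite mulrCA ler_wpM2l ?normc_ge0// hN.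
  rewrite -mulrA ler_piMr ?(ltW e0)// mulrC ler_pdivrMr// mul1r /K.
  by rewrite [X in _ <= X + 1]addrC lerDl.
have [N NP] := TF 1 ltr01; have [lF [M hM]] := bF N.
exists (M + 1).
by have := bounded_byB hM (NP N (leqnn N)); rewrite opprB addrCA subrr addr0.
Qed.
End OneSpace.
End Operators.

(** * Group ring elements in permutation representations *)

Section GroupRing.
Variables (R : realType) (G : groupType).
Local Notation nrm := ell2_norm.

Section OneAction.
Variables (S : choiceType) (a : left_action G S).
Implicit Types (x y : ell2 R S) (g h : G).
Local Notation pi := (perm_rep a).

Lemma perm_repE g x s : pi g x s = x (a g^-1%g s). Proof. by []. Qed.

Lemma perm_rep_linear g : linear (pi g : operator R S).
Proof. by move=> c x y; exact: ell2_ext. Qed.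

Lemma perm_rep_norm g x : nrm (pi g x) = nrm x.
Proof.
rewrite /ell2_norm; congr (Num.sqrt (fine _)).
rewrite -(@reindex_esum _ _ _ [set: S] [set: S] (a g^-1%g)
  (fun s => ((Normc.normc (x s)) ^+ 2)%:E))//.
split=> // [s t _ _ e|s _]; last by exists (a g s) => //;
  rewrite -act_mul mulVg act_one.
by rewrite -(act_one a s) -(mulgV g) act_mul e -act_mul mulgV act_one.
Qed.

Lemma perm_rep1 x : pi 1%g x = x.
Proof. by apply: ell2_ext => s; rewrite perm_repE invg1 act_one. Qed.

Lemma perm_repM g h x : pi (g * h)%g x = pi g (pi h x).
Proof. by apply: ell2_ext => s; rewrite !perm_repE invgM act_mul. Qed.

(** An invertible isometry preserves the inner product, by polarization. *)
Lemma perm_repV_adjoint g x y : inner (pi g x) y = inner x (pi g^-1%g y).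
Proof.
rewrite -[y in LHS]perm_rep1 -(mulgV g) perm_repM; set z := pi g^-1%g y.
rewrite !inner_polar /polar.
have e c : nrm (pi g x + c *: pi g z) = nrm (x + c *: z).
  by rewrite -(perm_rep_norm g (x + _)) addrC [x + _]addrC; congr nrm;
    rewrite perm_rep_linear.
by have := e 1; rewrite !scale1r => ->; rewrite !e.
Qed.

Lemma perm_rep_delta g s : pi g (delta R s) = delta R (a g s).
Proof.
apply: ell2_ext => t; rewrite perm_repE !deltaE; congr (nat_of_bool _)%:R.
apply/eqP/eqP => [<-|->]; first by rewrite -act_mul mulgV act_one.
by rewrite -act_mul mulVg act_one.
Qed.

(** Elements of the group ring are lists of coefficients and group elements, which
    makes it possible to evaluate the same element in two representations and
    to read off its support. *)
Definition rep (u : seq (R[i] * G)) : operator R S :=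
  fun x => \sum_(p <- u) p.1 *: pi p.2 x.

Lemma rep_linear u : linear (rep u).
Proof.
move=> c x y; rewrite /rep scaler_sumr -big_split /=; apply: eq_bigr => p _.
by rewrite perm_rep_linear scalerDr !scalerA mulrC.
Qed.

Definition coef_norm (u : seq (R[i] * G)) : R := \sum_(p <- u) Normc.normc p.1.

Lemma bounded_by_rep u : bounded_by (coef_norm u) (rep u).
Proof.
move=> x; apply: le_trans (ell2_norm_sum _ _ _) _; rewrite mulr_suml.
by apply: ler_sum => p _; rewrite ell2_normZ perm_rep_norm.
Qed.

Lemma bounded_operator_rep u : bounded_operator (rep u).
Proof. by split; [exact: rep_linear|exists (coef_norm u); exact: bounded_by_rep]. Qed.
End OneAction.

Definition fscale (c : R[i]) (u : seq (R[i] * G)) := [seq (c * p.1, p.2) | p <- u].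
Definition fmul (u v : seq (R[i] * G)) : seq (R[i] * G) :=
  [seq (p.1 * q.1, (p.2 * q.2)%g) | p <- u, q <- v].
Definition fstar (u : seq (R[i] * G)) : seq (R[i] * G) :=
  [seq (p.1^*%C, p.2^-1%g) | p <- u].

Section RepMorphism.
Variables (S : choiceType) (a : left_action G S).
Implicit Types u v : seq (R[i] * G).

Lemma rep_cat u v : rep a (u ++ v) = rep a u + rep a v.
Proof. by apply/funext => x; rewrite /rep big_cat. Qed.

Lemma rep_scale c u : rep a (fscale c u) = c *: rep a u.
Proof.
apply/funext => x; rewrite /rep big_map operatorZ scaler_sumr.
by apply: eq_bigr => p _ /=; rewrite scalerA.
Qed.

Lemma rep_mul u v : rep a (fmul u v) = rep a u \o rep a v.
Proof.
apply/funext => x /=; rewrite {1 2}/rep big_allpairs_dep /=; apply: eq_bigr => p _.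
rewrite (linear_opsum _ _ (@perm_rep_linear _ a p.2)) scaler_sumr.
apply: eq_bigr => q _; rewrite (linear_opZ _ _ (@perm_rep_linear _ a p.2)) scalerA.
by rewrite perm_repM.
Qed.

Lemma rep_star u : is_adjoint (rep a u) (rep a (fstar u)).
Proof.
move=> x y; rewrite /rep big_map.
elim/big_rec2 : _ => [|p z w _ IH]; first by rewrite inner0l inner0r.
by rewrite innerDl innerDr IH innerZl innerZr conjcK perm_repV_adjoint.
Qed.

Lemma rep1 g : rep a [:: (1, g)] = perm_rep a g.
Proof. by apply/funext => x; rewrite /rep big_seq1 scale1r. Qed.

Lemma rep_nil : rep a [::] = 0.
Proof. by apply/funext => x; rewrite /rep big_nil. Qed.

Lemma lin_span_rep (T : operator R S) :
  lin_span (range (perm_rep a)) T <-> exists u, T = rep a u.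
Proof.
split=> [[n [c [t [ht ->]]]]|[u ->]].
  have /choice[g gP] : forall i, exists g, perm_rep a g = t i.
    by move=> i; have [g _ <-] := ht i; exists g.
  exists [seq (c i, g i) | i <- index_enum 'I_n].
  apply/funext => x; rewrite /rep big_map fct_sumE /=.
  by apply: eq_bigr => i _; rewrite gP.
exists (size u), (fun i => (nth (0, 1%g) u i).1), (fun i => perm_rep a (nth (0,
  1%g) u i).2).
split=> [i|]; first by exists (nth (0, 1%g) u i).2.
apply/funext => x; rewrite /rep fct_sumE /= (big_nth (0, 1%g)) big_mkord.
by apply: eq_bigr.
Qed.

Lemma cstar_repP (T : operator R S) :
  cstar_rep (perm_rep a) T <->
  (bounded_operator T /\ forall e : R, 0 < e -> exists u, bounded_by e (T - rep a u)).
Proof.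
rewrite /cstar_rep norm_closureP; last first.
  by move=> U /lin_span_rep[u ->]; exact: bounded_operator_rep.
split=> -[bT h]; split => // e e0.
  by have [U /lin_span_rep[u ->] hu] := h e e0; exists u.
by have [u hu] := h e e0; exists (rep a u) => //; apply/lin_span_rep; exists u.
Qed.

Lemma cstar_rep_rep u : cstar_rep (perm_rep a) (rep a u).
Proof.
apply/cstar_repP; split; first exact: bounded_operator_rep.
by move=> e e0; exists u => x; rewrite subrr [nrm _]ell2_norm0 mulr_ge0 ?(ltW e0)
  ?ell2_norm_ge0.
Qed.
End RepMorphism.

Section Cubic.
Variable (S : choiceType).
Implicit Types (T U : operator R S).

Lemma cubic_norm_sqr T U (c : R) x : is_adjoint T U ->
  nrm (T x - c%:C%C *: T (U (T x))) ^+ 2 =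
  nrm (T x) ^+ 2 - 2 * c * nrm (U (T x)) ^+ 2 + c ^+ 2 * nrm (T (U (T x))) ^+ 2.
Proof.
move=> adj; apply: realC_inj; rewrite -inner_self innerBl !innerBr !innerZl !innerZr.
have e : inner (T (U (T x))) (T x) = (nrm (U (T x)) ^+ 2)%:C%C by rewrite adj
  inner_self.
rewrite (inner_conj (T (U (T x))) (T x)) e !inner_self.
rewrite ![(_%:C)^*%C]conjc_real realCD realCB !realCM; ring.
Qed.

(** By [cubic_norm_sqr], and with q = T (U (T x)), the square of the norm is at
    most ||T x||^2 - c (2 - c M^2) ||U (T x)||^2 since ||q|| <= M ||U (T x)||. *)
Lemma cubic_contract T U (c M : R) :
  is_adjoint T U -> 0 <= M -> 0 <= c -> c * M ^+ 2 <= 2 ->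
  bounded_by M T -> bounded_by M (fun x => T x - c%:C%C *: T (U (T x))).
Proof.
move=> adj M0 c0 cM hT x.
rewrite -(@ler_pXn2r _ 2)// ?nnegrE ?mulr_ge0 ?ell2_norm_ge0//.
rewrite (cubic_norm_sqr _ _ adj).
have h1 : nrm (T x) ^+ 2 <= (M * nrm x) ^+ 2.
  by rewrite ler_pXn2r ?nnegrE ?mulr_ge0 ?ell2_norm_ge0.
have h2 : nrm (T (U (T x))) ^+ 2 <= (M * nrm (U (T x))) ^+ 2.
  by rewrite ler_pXn2r ?nnegrE ?mulr_ge0 ?ell2_norm_ge0.
apply: le_trans h1; rewrite -addrA gerDl.
apply: (@le_trans _ _ (- (2 * c * nrm (U (T x)) ^+ 2) + c ^+ 2 * (M * nrm (U (T x)))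
  ^+ 2)).
  by rewrite lerD2l ler_wpM2l// sqr_ge0.
have -> : - (2 * c * nrm (U (T x)) ^+ 2) + c ^+ 2 * (M * nrm (U (T x))) ^+ 2 =
  - (c * nrm (U (T x)) ^+ 2 * (2 - c * M ^+ 2)) by ring.
by rewrite oppr_le0 mulr_ge0 ?subr_ge0// mulr_ge0// sqr_ge0.
Qed.

(** For a scalar t of [0, M], the value t (1 - t^2 / M^2) is at most
    sqrt (4 / 27) M, which is less than M / 2. With p = t^2 / M^2 this rests on
    4 / 27 - p (1 - p)^2 = (p - 1 / 3)^2 (4 / 3 - p); the operator version of
    the right-hand side is the bound on T at the vector w of the proof. *)
Lemma cubic_half T U (M : R) : linear T -> is_adjoint T U -> 0 < M -> bounded_by M T ->
  bounded_by (M / 2) (fun x => T x - (M ^- 2)%:C%C *: T (U (T x))).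
Proof.
move=> lT adj M0 hT x; set c := M ^- 2.
have cM : c * M ^+ 2 = 1 by rewrite /c mulVf// expf_neq0// gt_eqF.
rewrite -(@ler_pXn2r _ 2)// ?nnegrE ?mulr_ge0 ?ell2_norm_ge0 ?invr_ge0 ?(ltW M0)//.
rewrite (cubic_norm_sqr _ _ adj).
set u := T x; set v := U u; set q := T v.
(* the operator analogue of p - 1 / 3, applied to x *)
pose w := c%:C%C *: v - 3^-1%:C%C *: x.
have hw : nrm (T w) ^+ 2 <= M ^+ 2 * nrm w ^+ 2.
  by rewrite -exprMn ler_pXn2r ?nnegrE ?mulr_ge0 ?ell2_norm_ge0 ?(ltW M0).
have inner_qu : inner q u = (nrm v ^+ 2)%:C%C by rewrite /q adj inner_self.
have inner_vx : inner v x = (nrm u ^+ 2)%:C%C.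
  by rewrite inner_conj -adj inner_self conjc_real.
have wE : nrm w ^+ 2 = c ^+ 2 * nrm v ^+ 2 - 2 / 3 * c * nrm u ^+ 2 + nrm x ^+ 2 / 9.
  apply: realC_inj; rewrite -inner_self /w innerBl !innerBr !innerZl !innerZr.
  rewrite (inner_conj v x) inner_vx !inner_self ![(_%:C)^*%C]conjc_real.
  by simpc; apply/eqP; rewrite eq_complex /=; apply/andP; split; apply/eqP;
    [field|ring].
have TwE : nrm (T w) ^+ 2 = c ^+ 2 * nrm q ^+ 2 - 2 / 3 * c * nrm v ^+ 2 + nrm u ^+ 2
  / 9.
  rewrite /w (linear_opB _ _ lT) !(linear_opZ _ _ lT) -/u -/q.
  apply: realC_inj; rewrite -inner_self innerBl !innerBr !innerZl !innerZr.
  rewrite (inner_conj q u) inner_qu !inner_self ![(_%:C)^*%C]conjc_real.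
  by simpc; apply/eqP; rewrite eq_complex /=; apply/andP; split; apply/eqP;
    [field|ring].
have w0 : 0 <= M ^+ 2 * nrm w ^+ 2 by rewrite mulr_ge0// sqr_ge0.
have e1 : M ^+ 2 * nrm w ^+ 2 = c * nrm v ^+ 2 - 2 / 3 * nrm u ^+ 2 + M ^+ 2 * nrm x
  ^+ 2 / 9.
  rewrite wE; transitivity (c * (c * M ^+ 2) * nrm v ^+ 2 - 2 / 3 * (c * M ^+ 2) *
    nrm u ^+ 2 + M ^+ 2 * nrm x ^+ 2 / 9).
    by field.
  by rewrite cM !mulr1.
have MX : 0 <= M ^+ 2 * nrm x ^+ 2 by rewrite mulr_ge0// sqr_ge0.
rewrite e1 in hw w0; rewrite TwE in hw.
have -> : (M / 2 * nrm x) ^+ 2 = M ^+ 2 * nrm x ^+ 2 / 4 by field.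
lra.
Qed.
End Cubic.
End GroupRing.

(** * Weak containment and the closure of the graph *)

Section Factorization.
Variables (R : realType) (G : groupType) (S S' : choiceType).
Variables (a : left_action G S) (b : left_action G S').
Local Notation nrm := ell2_norm.

(** Weak containment of the representation of b in that of a, in its
    C*-algebraic form. *)
Definition weakly_contains : Prop := forall u (M : R),
  0 <= M -> bounded_by M (rep (R := R) a u) -> bounded_by M (rep (R := R) b u).

Hypothesis wcont : weakly_contains.

(** The norm closure of the set of pairs (rep a u, rep b u). Under weak
    containment it is the graph of a *-homomorphism, and its algebraic
    properties are those of the group ring. *)
Definition graph_closure (T : operator R S) (T' : operator R S') : Prop :=
  [/\ bounded_operator T, bounded_operator T' &
      forall e : R, 0 < e -> exists u,
        bounded_by e (T - rep a u) /\ bounded_by e (T' - rep b u)].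

Local Notation Rel := graph_closure.
Local Notation A := (cstar_rep (perm_rep (R := R) a)).
Local Notation B := (cstar_rep (perm_rep (R := R) b)).

Lemma rep_sub (V : choiceType) (d : left_action G V) u v :
  rep d (fscale (-1) u ++ v) = rep d v - rep d u :> operator R V.
Proof. by rewrite rep_cat rep_scale scaleN1r addrC. Qed.

Lemma graph_closurel T T' : Rel T T' -> A T.
Proof.
by move=> [bT bT' h]; apply/cstar_repP; split => // e /h[u []]; exists u.
Qed.

Lemma graph_closurer T T' : Rel T T' -> B T'.
Proof.
by move=> [bT bT' h]; apply/cstar_repP; split => // e /h[u []]; exists u.
Qed.

Lemma bounded_by_le_eps (V V' : choiceType) (M : R) (T : ell2 R V -> ell2 R V') :
  (forall e : R, 0 < e -> bounded_by (M + e) T) -> bounded_by M T.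
Proof.
move=> h x; apply/ler_addgt0Pr => e e0.
have x1 : 0 < nrm x + 1 by rewrite ltr_wpDl// ell2_norm_ge0.
apply: le_trans (h (e / (nrm x + 1)) _ x) _; first by rewrite divr_gt0.
rewrite mulrDl lerD2l.
by rewrite -mulrA ler_piMr ?(ltW e0)// mulrC ler_pdivrMr// mul1r lerDl.
Qed.

(** Weak containment compares the norms of rep a u and rep b u for a u that
    approximates both T and T'. *)
Lemma graph_closure_contract T T' M :
  0 <= M -> Rel T T' -> bounded_by M T -> bounded_by M T'.
Proof.
move=> M0 [bT bT' h] hT; apply: bounded_by_le_eps => e e0.
have e2 : 0 < e / 2 by rewrite divr_gt0.
have [u [h1 h2]] := h (e / 2) e2.
have h3 : bounded_by (M + e / 2) (rep (R := R) a u).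
  by have := bounded_byB hT h1; rewrite opprB addrCA subrr addr0.
have h4 := wcont (addr_ge0 M0 (ltW e2)) h3.
have := bounded_byD h4 h2; rewrite addrCA subrr addr0; apply: bounded_by_le.
by rewrite -addrA lerD2l; lra.
Qed.

Lemma graph_closure_rep u : Rel (rep a u) (rep b u).
Proof.
split; [exact: bounded_operator_rep..|].
by move=> e e0; exists u; split => x; rewrite subrr [nrm _]ell2_norm0 mulr_ge0 ?(ltW
  e0) ?ell2_norm_ge0.
Qed.

Lemma graph_closure_linear c T T' U U' : Rel T T' -> Rel U U' ->
  Rel (c *: T + U) (c *: T' + U').
Proof.
move=> [bT bT' hT] [bU bU' hU]; split; [exact: bounded_operator_linear..|].
move=> e e0; pose K := Normc.normc c + 1.
have K0 : 0 < K by rewrite ltr_wpDl// normc_ge0.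
have [u [hu hu']] := hT (e / (2 * K)) (divr_gt0 e0 (mulr_gt0 (ltr0Sn _ 1) K0)).
have [v [hv hv']] := hU (e / 2) (divr_gt0 e0 (ltr0Sn _ 1)).
have le_e : Normc.normc c * (e / (2 * K)) + e / 2 <= e.
  have : Normc.normc c * (e / (2 * K)) <= e / 2.
    rewrite [leRHS](_ : _ = K * (e / (2 * K))).
      by rewrite ler_wpM2r ?divr_ge0 ?mulr_ge0 ?(ltW e0) ?(ltW K0)// lerDl.
    by field; rewrite gt_eqF.
  by move=> ?; lra.
exists (fscale c u ++ v); split; apply: bounded_by_le le_e _;
  rewrite rep_cat rep_scale opprD addrACA -scalerBr; apply: bounded_byD => //;
    exact: bounded_byZ.
Qed.

Lemma graph_closure_sub T T' U U' : Rel T T' -> Rel U U' -> Rel (T - U) (T' - U').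
Proof.
move=> h k; rewrite -[- U]scaleN1r -[- U']scaleN1r addrC [T' + _]addrC.
exact: graph_closure_linear.
Qed.

Lemma graph_closure_uniq T T' U' : Rel T T' -> Rel T U' -> T' = U'.
Proof.
move=> h k; apply/eqP; rewrite -subr_eq0; apply/eqP; apply: bounded_by_eq0 => e e0.
apply: (graph_closure_contract (ltW e0) (graph_closure_sub h k)) => x.
by rewrite subrr [nrm _]ell2_norm0 mulr_ge0 ?(ltW e0) ?ell2_norm_ge0.
Qed.

Lemma operator_mul_approx (V : choiceType) (T U T1 U1 : operator R V) (M N e : R) :
  linear T ->
  0 <= M -> 0 <= N -> 0 <= e -> e <= 1 ->
  bounded_by M T -> bounded_by N U -> bounded_by e (T - T1) -> bounded_by e (U - U1) ->
  bounded_by (e * (M + N + 1)) ((T \o U) - (T1 \o U1)).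
Proof.
move=> lT M0 N0 e0 e1 hT hU h1 h2.
have -> : (T \o U) - (T1 \o U1) = (T \o (U - U1)) + ((T - T1) \o U1).
  apply/funext => x; transitivity (T (U x - U1 x) + (T (U1 x) - T1 (U1 x))) => //.
  by rewrite (linear_opB _ _ lT) addrA subrK.
have hU1 : bounded_by (N + e) U1.
  by have := bounded_byB hU h2; rewrite opprB addrCA subrr addr0.
have := bounded_byD (bounded_byM M0 hT h2) (bounded_byM e0 h1 hU1).
apply: bounded_by_le; nra.
Qed.

Lemma graph_closure_mul T T' U U' : Rel T T' -> Rel U U' -> Rel (T \o U) (T' \o U').
Proof.
move=> [bT bT' hT] [bU bU' hU]; split; [exact: bounded_operatorM..|] => e e0.
have [lT [M [M0 hM]]] := bounded_operatorP bT.
have [lT' [M' [M0' hM']]] := bounded_operatorP bT'.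
have [lU [N [N0 hN]]] := bounded_operatorP bU.
have [lU' [N' [N0' hN']]] := bounded_operatorP bU'.
pose K := M + N + M' + N' + 1.
have K0 : 0 < K by rewrite /K; lra.
(* the bound d <= 1 makes the error terms linear in d *)
pose d := Num.min 1 (e / K).
have d0 : 0 < d by rewrite lt_min ltr01 divr_gt0.
have d1 : d <= 1 by rewrite ge_min lexx.
have dK : d * K <= e by rewrite -ler_pdivlMr// ge_min lexx orbT.
have [u [hu hu']] := hT d d0; have [v [hv hv']] := hU d d0.
exists (fmul u v); rewrite !rep_mul; split.
  apply: bounded_by_le (operator_mul_approx lT (ltW M0) (ltW N0) (ltW d0) d1 hM hN hu
    hv).
  by apply: le_trans dK; rewrite ler_wpM2l ?(ltW d0)// /K; lra.
apply: bounded_by_le (operator_mul_approx lT' (ltW M0') (ltW N0') (ltW d0) d1 hM' hN'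
  hu' hv').
by apply: le_trans dK; rewrite ler_wpM2l ?(ltW d0)// /K; lra.
Qed.

Lemma is_adjointB (V : choiceType) (T U T1 U1 : operator R V) :
  is_adjoint T T1 -> is_adjoint U U1 ->
  is_adjoint (T - U) (T1 - U1).
Proof. by move=> h k x y; rewrite !operatorB innerBl innerBr h k. Qed.

(** If u approximates (T, T') and v approximates (U, U'), then the adjoint of u
    and v have close images under rep a, hence also under rep b. *)
Lemma graph_closure_adjoint T T' U U' :
  Rel T T' -> Rel U U' -> is_adjoint T U -> is_adjoint T' U'.
Proof.
move=> [bT bT' hT] [bU bU' hU] adj x y.
apply/eqP; rewrite -subr_eq0; apply/eqP; apply: Normc.eq0_normc.
apply/eqP; rewrite eq_le normc_ge0 andbT; apply/ler_addgt0Pl => e e0; rewrite addr0.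
pose K := nrm x * nrm y + 1.
have K0 : 0 < K by rewrite /K ltr_wpDl// mulr_ge0// ell2_norm_ge0.
(* T' - rep b u is bounded by d and U' - rep b u' by 3 d, u' the adjoint of u *)
pose d := e / (4 * K).
have d0 : 0 < d by rewrite divr_gt0// mulr_gt0.
have [u [hu hu']] := hT d d0; have [v [hv hv']] := hU d d0.
have h1 : bounded_by d (U - rep a (fstar u)).
  exact: bounded_by_adjoint (ltW d0) (is_adjointB adj (rep_star a u)) hu.
have h2 : bounded_by (d + d) (rep b (fscale (-1) (fstar u) ++ v) : operator R S').
  apply: wcont; first by rewrite addr_ge0// ltW.
  rewrite rep_sub; apply: bounded_by_dist3 h1; exact: bounded_by_distC.
have h3 : bounded_by (d + (d + d)) (U' - rep b (fstar u)).
  move: h2; rewrite rep_sub => h2.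
  exact: bounded_by_dist3 hv' h2.
have -> : inner (T' x) y - inner x (U' y) =
    inner ((T' - rep b u) x) y - inner x ((U' - rep b (fstar u)) y).
  by rewrite !operatorB innerBl innerBr rep_star opprB addrA subrK.
apply: le_trans (le_normcD _ _) _; rewrite normc_opp.
apply: le_trans (lerD (ell2_cauchy_schwarz _ _) (ell2_cauchy_schwarz _ _)) _.
apply: (@le_trans _ _ (d * nrm x * nrm y + nrm x * ((d + (d + d)) * nrm y))).
  by apply: lerD; [rewrite ler_wpM2r ?ell2_norm_ge0|rewrite ler_wpM2l ?ell2_norm_ge0].
have -> : e = 4 * d * K by rewrite /d; field; rewrite gt_eqF.
have : 0 <= d by exact: ltW.
by rewrite /K; set p := nrm x; set q := nrm y => _; lra.
Qed.

Lemma graph_closure_limit (F : nat -> operator R S) (F' : nat -> operator R S') T T' :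
  bounded_operator T -> bounded_operator T' ->
  (forall n, Rel (F n) (F' n)) ->
  (forall e : R, 0 < e -> exists N, forall n, (N <= n)%N -> bounded_by e (F n - T)) ->
  (forall e : R, 0 < e -> exists N, forall n, (N <= n)%N -> bounded_by e (F' n - T')) ->
  Rel T T'.
Proof.
move=> bT bT' hF cF cF'; split => // e e0.
have e2 : 0 < e / 2 by rewrite divr_gt0.
have [N hN] := cF (e / 2) e2; have [N' hN'] := cF' (e / 2) e2.
pose n := maxn N N'; have [_ _ /(_ (e / 2) e2)[u [h1 h2]]] := hF n.
have eE : e = e / 2 + e / 2 by lra.
exists u; rewrite eE; split; [apply: bounded_by_dist3 h1|apply: bounded_by_dist3 h2];
  apply: bounded_by_distC; [apply: hN|apply: hN']; rewrite ?leq_maxl ?leq_maxr//.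
Qed.

Lemma invn_small (e : R) : 0 < e -> exists N, forall n, (N <= n)%N -> n.+1%:R^-1 <= e.
Proof.
move=> e0; exists (Num.truncn e^-1) => n Nn.
rewrite -[e]invrK lef_pV2 ?posrE ?invr_gt0 ?ltr0Sn//.
by apply: ltW; apply: lt_le_trans (truncnS_gt _) _; rewrite ler_nat ltnS.
Qed.

Lemma graph_closure_ex T : A T -> exists T', Rel T T'.
Proof.
move=> /cstar_repP[bT h].
have /choice[u uP] : forall n : nat, exists u, bounded_by n.+1%:R^-1 (T - rep a u).
  by move=> n; apply: h; rewrite invr_gt0 ltr0Sn.
have cT (e : R) : 0 < e -> exists N, forall n, (N <= n)%N ->
  bounded_by e (rep a (u n) - T).
  move=> e0; have [N NP] := invn_small e0; exists N => n Nn.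
  by apply: bounded_by_distC; apply: bounded_by_le (NP n Nn) (uP n).
have [|e e0|T' [bT' cT']] := @operator_complete R S' (fun n => rep b (u n)).
- by move=> n; exact: bounded_operator_rep.
- have e2 : 0 < e / 2 by rewrite divr_gt0.
  have [N NP] := cT (e / 2) e2; exists N => n m Nn Nm.
  have : bounded_by e (rep b (fscale (-1) (u m) ++ u n) : operator R S').
    apply: wcont; first exact: ltW.
    rewrite rep_sub (_ : e = e / 2 + e / 2); last lra.
    by apply: bounded_by_dist3 (NP _ Nn) _; apply: bounded_by_distC; exact: NP.
  by rewrite rep_sub.
exists T'; apply: graph_closure_limit cT cT' => // n; exact: graph_closure_rep.
Qed.

(** u - c u u' u, with u' the adjoint of u. *)
Definition cubic (c : R) u : seq (R[i] * G) :=
  u ++ fscale (- c%:C%C) (fmul u (fmul (fstar u) u)).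

Lemma rep_cubic (V : choiceType) (d : left_action G V) c u :
  rep d (cubic c u) = (fun x => rep d u x - c%:C%C *: rep d u (rep d (fstar u) (rep d
    u x))) :> operator R V.
Proof.
by rewrite rep_cat rep_scale !rep_mul; apply/funext => x;
  rewrite operatorD operatorZ /= scaleNr.
Qed.

(** Each application of [cubic] with c = M^-2, M = 4 r 2^n, halves the bound on
    the first image and, as the second image keeps norm at most 2 r, moves it by
    at most M^-2 (2 r)^3, which is r / (2 * 4^n). The factor of r / 6 in the
    conclusion is the sum of these losses over the levels 1, ..., n. *)
Lemma lift_levels (r : R) n u : 0 < r ->
  bounded_by (4 * r * 2 ^+ n) (rep a u : operator R S) ->
    bounded_by (2 * r) (rep b u : operator R S') ->
  exists v, bounded_by (4 * r) (rep a v : operator R S) /\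
    bounded_by (r / 6 * (1 - (2 ^+ n) ^- 2)) (rep b u - rep b v : operator R S').
Proof.
move=> r0; elim: n u => [|n IH] u hu hu'.
  exists u; split; first by move: hu; rewrite expr0 mulr1.
  by move=> x; rewrite subrr [nrm _]ell2_norm0 expr0 expr1n invr1 subrr mulr0 mul0r.
pose M := 4 * r * 2 ^+ n.+1; pose y : R := 2 ^+ n.
have y0 : 0 < y by rewrite exprn_gt0.
have y1 : 1 <= y by rewrite exprn_ege1// ler1n.
have ME : M = 8 * r * y by rewrite /M exprS -/y; ring.
have M0 : 0 < M by rewrite ME !mulr_gt0.
have r20 : 0 <= 2 * r by rewrite mulr_ge0// ltW.
have c0 : 0 <= M ^- 2 by rewrite invr_ge0 exprn_ge0// ltW.
have h1 : bounded_by (4 * r * 2 ^+ n) (rep a (cubic (M ^- 2) u) : operator R S).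
  rewrite (_ : 4 * r * 2 ^+ n = M / 2); last by rewrite ME -/y; field.
  by rewrite rep_cubic; apply: cubic_half => //; [exact: rep_linear|exact: rep_star].
have h2 : bounded_by (2 * r) (rep b (cubic (M ^- 2) u) : operator R S').
  rewrite rep_cubic; apply: cubic_contract => //; first exact: rep_star.
  rewrite mulrC ler_pdivrMr ?exprn_gt0//.
  have hM : 2 * r <= M by rewrite ME; nra.
  have : (2 * r) ^+ 2 <= M ^+ 2 by rewrite ler_pXn2r ?nnegrE// ltW.
  by have := sqr_ge0 M; lra.
have [v [hv hv']] := IH _ h1 h2.
exists v; split => //.
have h3 : bounded_by (M ^- 2 * (2 * r) ^+ 3) (rep b u - rep b (cubic (M ^- 2) u) :
  operator R S').
  rewrite rep_cubic => x; rewrite operatorB opprB addrCA subrr addr0.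
  rewrite ell2_normZ normc_real ger0_norm// -mulrA ler_wpM2l//.
  rewrite (_ : (2 * r) ^+ 3 * nrm x = (2 * r) * ((2 * r) * ((2 * r) * nrm x)));
    last by ring.
  apply: le_trans (hu' _) _; rewrite ler_wpM2l//.
  apply: le_trans (bounded_by_adjoint r20 (rep_star b u) hu' _) _; rewrite ler_wpM2l//.
apply: bounded_by_le (bounded_by_dist3 h3 hv').
rewrite -/y [2 ^+ n.+1]exprS -/y ME le_eqVlt; apply/orP; left; apply/eqP; field.
by rewrite !gt_eqF.
Qed.

Lemma pow2_unbounded (x : R) : exists n, x <= 2 ^+ n.
Proof.
exists (Num.truncn x).+1; apply: ltW; apply: lt_le_trans (truncnS_gt _) _.
by rewrite -natrX ler_nat ltnW// ltn_expl.
Qed.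

Lemma lift_step (r : R) T' : 0 < r -> B T' -> bounded_by r T' ->
  exists v, bounded_by (4 * r) (rep a v : operator R S) /\ bounded_by (r / 2) (T' -
    rep b v).
Proof.
move=> r0 /cstar_repP[bT' h] hT'.
have [u hu] := h (r / 4) (divr_gt0 r0 (ltr0Sn _ 3)).
have hu' : bounded_by (2 * r) (rep b u : operator R S').
  have := bounded_byB hT' hu; rewrite opprB addrCA subrr addr0.
  by apply: bounded_by_le; lra.
have [n hn] := pow2_unbounded (coef_norm u / (4 * r)).
have h1 : bounded_by (4 * r * 2 ^+ n) (rep a u : operator R S).
  apply: bounded_by_le (bounded_by_rep a u).
  by rewrite mulrC -ler_pdivrMr// mulr_gt0.
have [v [hv hv']] := lift_levels r0 h1 hu'.
exists v; split => //; apply: bounded_by_le (bounded_by_dist3 hu hv').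
have : 0 <= (2 ^+ n : R) ^- 2 by rewrite invr_ge0 exprn_ge0// exprn_ge0.
nra.
Qed.

(** Lift T' up to an error of half its norm, then lift the error, and so on: the
    successive lifts are bounded by a geometric series. *)
Lemma graph_closure_surj T' : B T' -> exists T, Rel T T'.
Proof.
move=> BT'; have [bT' hB] := (cstar_repP _ _).1 BT'.
have [lT' [r [r0 hr]]] := bounded_operatorP bT'.
have /choice[f fP] : forall p : nat * seq (R[i] * G), exists v,
    bounded_by (r / 2 ^+ p.1) (T' - rep b p.2) ->
    bounded_by (4 * (r / 2 ^+ p.1)) (rep a v : operator R S) /\
    bounded_by (r / 2 ^+ p.1.+1) (T' - rep b (p.2 ++ v)).
  move=> [n u] /=.
  have [h|h] := pselect (bounded_by (r / 2 ^+ n) (T' - rep b u)); last by exists [::].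
  have BU : B (T' - rep b u).
    apply/cstar_repP; split; first by apply: bounded_operatorB => //;
      exact: bounded_operator_rep.
    move=> e /hB[v hv]; exists (fscale (-1) u ++ v).
    by rewrite rep_sub opprB addrA subrK.
  have [|v [h1 h2]] := lift_step _ BU h; first by rewrite divr_gt0// exprn_gt0.
  exists v => _; split => //; rewrite rep_cat opprD addrA exprSr invfM mulrA.
  exact: h2.
(* w n lifts T' up to an error r / 2^n *)
pose w := fix w n := if n is m.+1 then w m ++ f (m, w m) else [::].
have wP n : bounded_by (r / 2 ^+ n) (T' - rep b (w n)).
  elim: n => [|n IH]; first by rewrite expr0 divr1 rep_nil subr0.
  by have [] := fP (n, w n) IH.
have wa n : bounded_by (4 * (r / 2 ^+ n)) (rep a (w n.+1) - rep a (w n) : operator R S).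
  by have [h _] := fP (n, w n) (wP n); rewrite /= rep_cat addrAC subrr add0r.
have wd n d : bounded_by (8 * (r / 2 ^+ n) - 8 * (r / 2 ^+ (n + d)))
    (rep a (w (n + d)%N) - rep a (w n) : operator R S).
  elim: d => [|d IH].
    by move=> x; rewrite addn0 !subrr [nrm _]ell2_norm0 mul0r.
  rewrite addnS; apply: bounded_by_le (bounded_by_dist3 (wa _) IH).
  rewrite [2 ^+ (n + d).+1]exprS invfM le_eqVlt; apply/orP; left; apply/eqP; field.
  by rewrite !expf_neq0.
have small (K e : R) : 0 < K -> 0 < e -> exists N, forall n, (N <= n)%N ->
  K / 2 ^+ n <= e.
  move=> K0 e0; have [N NP] := pow2_unbounded (K / e); exists N => n Nn.
  rewrite ler_pdivrMr ?exprn_gt0// mulrC -ler_pdivrMr//; apply: le_trans NP _.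
  by rewrite ler_eXn2l// ltr1n.
have [|e e0|T [bT cT]] := @operator_complete R S (fun n => rep a (w n)).
- by move=> n; exact: bounded_operator_rep.
- have [N NP] := small (16 * r) e (mulr_gt0 (ltr0Sn _ 15) r0) e0.
  have hN n : (N <= n)%N -> bounded_by (e / 2) (rep a (w n) - rep a (w N) :
    operator R S).
    move=> Nn; rewrite -(subnKC Nn); apply: bounded_by_le (wd N _).
    have := NP N (leqnn N).
    have : 0 <= r / 2 ^+ (N + (n - N)) by rewrite divr_ge0 ?(ltW r0)// exprn_ge0.
    lra.
  exists N => n m Nn Nm; rewrite (_ : e = e / 2 + e / 2); last lra.
  by apply: bounded_by_dist3 (hN n Nn) _; apply: bounded_by_distC; exact: hN.
exists T; apply: (graph_closure_limit _ _ _ cT) => //.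
  by move=> n; exact: graph_closure_rep.
move=> e e0; have [N NP] := small r e r0 e0; exists N => n Nn.
by apply: bounded_by_distC; apply: bounded_by_le (NP n Nn) (wP n).
Qed.
End Factorization.

(** * The factor map and the quotient by its kernel *)

Section FactorMap.
Variables (R : realType) (G : groupType) (S S' : choiceType).
Variables (a : left_action G S) (b : left_action G S').
Hypothesis wcont : weakly_contains R a b.
Local Notation nrm := ell2_norm.
Local Notation Rel := (@graph_closure R G S S' a b).
Local Notation A := (cstar_rep (perm_rep (R := R) a)).
Local Notation B := (cstar_rep (perm_rep (R := R) b)).

(** The junk value 0 is taken off the domain of the closed graph. *)
Definition factor_map (T : operator R S) : operator R S' :=
  if pselect (exists T', Rel T T') is left h then projT1 (cid h) else 0.

Lemma factor_mapP T : A T -> Rel T (factor_map T).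
Proof.
move=> AT; rewrite /factor_map; case: pselect => [h|]; first by case: cid.
by move=> []; exact: graph_closure_ex.
Qed.

Lemma factor_mapE T T' : Rel T T' -> factor_map T = T'.
Proof.
by move=> h; apply: (graph_closure_uniq wcont _ h); apply: factor_mapP;
  exact: graph_closurel h.
Qed.

Lemma star_hom_factor_map : star_hom A factor_map.
Proof.
split.
- by move=> T /factor_mapP[].
- move=> c T U AT AU; apply: factor_mapE; exact: graph_closure_linear (factor_mapP
  AT) (factor_mapP AU).
- move=> T U AT AU; apply: factor_mapE; exact: graph_closure_mul (factor_mapP AT)
  (factor_mapP AU).
- move=> T U AT AU; exact: graph_closure_adjoint (factor_mapP AT) (factor_mapP AU).
Qed.

Lemma factor_map_rep u : factor_map (rep a u) = rep b u.
Proof. by apply: factor_mapE; exact: graph_closure_rep. Qed.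

Lemma factor_map_perm g : factor_map (perm_rep a g) = perm_rep b g.
Proof. by rewrite -!rep1 factor_map_rep. Qed.

Lemma cstar_bounded T : A T -> bounded_operator T.
Proof. by move=> /cstar_repP[]. Qed.

(** [norm_closure] is idempotent. *)
Lemma cstar_closed T : norm_closure A T -> A T.
Proof.
move=> /(norm_closureP _ cstar_bounded)[bT h]; apply/cstar_repP; split => // e e0.
have e2 : 0 < e / 2 by rewrite divr_gt0.
have [U AU hU] := h (e / 2) e2; have [_ /(_ (e / 2) e2)[u hu]] := (cstar_repP _ _).1 AU.
by exists u; rewrite (_ : e = e / 2 + e / 2); [exact: bounded_by_dist3 hU hu|lra].
Qed.

Lemma cstar_linear c T U : A T -> A U -> A (c *: T + U).
Proof. by move=> /factor_mapP h /factor_mapP k;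
  exact: graph_closurel (graph_closure_linear c h k). Qed.

Lemma cstar_mul T U : A T -> A U -> A (T \o U).
Proof. by move=> /factor_mapP h /factor_mapP k;
  exact: graph_closurel (graph_closure_mul h k). Qed.

Lemma cstar0 : A 0. Proof. by rewrite -(rep_nil R a); exact: cstar_rep_rep. Qed.

Local Notation I := (star_hom_kernel A factor_map).

Lemma factor_map0 : factor_map 0 = 0.
Proof. by rewrite -(rep_nil R a) factor_map_rep rep_nil. Qed.

Lemma factor_mapB T U : A T -> A U -> factor_map (T - U) = factor_map T - factor_map U.
Proof.
by move=> /factor_mapP h /factor_mapP k; apply: factor_mapE;
  exact: graph_closure_sub h k.
Qed.

Lemma cstarB T U : A T -> A U -> A (T - U).
Proof. by move=> h k; rewrite addrC -scaleN1r; exact: cstar_linear. Qed.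

Lemma cstarD T U : A T -> A U -> A (T + U).
Proof. by move=> h k; have := cstar_linear 1 h k; rewrite scale1r. Qed.

Lemma factor_mapD T U : A T -> A U -> factor_map (T + U) = factor_map T + factor_map U.
Proof.
move=> /factor_mapP h /factor_mapP k; apply: factor_mapE.
by have := graph_closure_linear 1 h k; rewrite !scale1r.
Qed.

Lemma closed_ideal_kernel : closed_ideal A I.
Proof.
have [_ hl hm _] := star_hom_factor_map.
split.
- by move=> T [].
- by split; [exact: cstar0|exact: factor_map0].
- move=> c s t [As ks] [At kt]; split; first exact: cstar_linear.
  by rewrite /= hl//= ks kt scaler0 addr0.
- move=> s t As [At kt]; split; first exact: cstar_mul.
  rewrite /= hm//= kt; have [_ [lT _] _] := factor_mapP As.
  by apply/funext => x /=; rewrite (linear_op0 lT).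
- move=> s t As [At kt]; split; first exact: cstar_mul.
  by rewrite /= hm//= kt.
- have Ib : I `<=` @bounded_operator R S by move=> T [/cstar_bounded].
  move=> T /(norm_closureP _ Ib)[bT h].
  have AT : A T.
    apply: cstar_closed; apply/(norm_closureP _ cstar_bounded); split => // e e0.
    by have [U [AU _] hU] := h e e0; exists U.
  split => //=; apply: bounded_by_eq0 => e e0; have [U [AU kU] hU] := h e e0.
  have := graph_closure_contract wcont (ltW e0) (graph_closure_sub (factor_mapP AT)
    (factor_mapP AU)) hU.
  by rewrite kU subr0.
Qed.

Lemma proper_closed_ideal_kernel (s' : S') : proper_closed_ideal A I.
Proof.
split; first exact: closed_ideal_kernel.
move=> IA; have : A (perm_rep a 1%g) by rewrite -rep1; exact: cstar_rep_rep.
rewrite -IA => -[_ /=]; rewrite factor_map_perm => /(congr1 (fun T : operator R S' =>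
  T (delta R s') s')).
by rewrite perm_rep1 deltaE eqxx => /eqP; rewrite oner_eq0.
Qed.

(** The homomorphism theorem: cosets of the kernel are the fibres. *)
Lemma ideal_cosetP T U : A T -> A U ->
  ideal_coset I T = ideal_coset I U <-> factor_map T = factor_map U.
Proof.
move=> AT AU; split=> [e|e].
  have : ideal_coset I T T by exists 0; [split;
    [exact: cstar0|exact: factor_map0]|rewrite addr0].
  rewrite e => -[V [AV /= kV] VE].
  have VE' : V = T - U by rewrite -VE addrC addKr.
  by apply/eqP; rewrite -subr_eq0 -factor_mapB// -VE' kV.
have sub T1 U1 : A T1 -> A U1 -> factor_map T1 = factor_map U1 ->
    ideal_coset I T1 `<=` ideal_coset I U1.
  move=> AT1 AU1 e1 _ [V [AV /= kV] <-]; have AD := cstarB AT1 AU1.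
  exists (T1 - U1 + V); last by rewrite addrA (addrC U1 (T1 - U1)) (subrK U1 T1).
  split; first exact: cstarD.
  by rewrite /= (factor_mapD AD AV) (factor_mapB AT1 AU1) e1 subrr kV addr0.
by apply/seteqP; split; [exact: (sub _ _ AT AU e)|exact: (sub _ _ AU AT (esym e))].
Qed.

Lemma quotient_isomorphic_factor_map : quotient_isomorphic A I B.
Proof.
pose Psi (C : set (operator R S)) : operator R S' :=
  if pselect (exists T, A T /\ C = ideal_coset I T) is left h then factor_map (projT1
    (cid h)) else 0.
have PsiE T : A T -> Psi (ideal_coset I T) = factor_map T.
  move=> AT; rewrite /Psi; case: pselect => [h|]; last by case; exists T.
  by case: cid => U [AU e] /=; apply/esym/(ideal_cosetP AT AU).
exists Psi; split.
  have [hb hl hm ha] := star_hom_factor_map; split.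
  - by move=> T AT; rewrite (PsiE _ AT); exact: hb.
  - by move=> c T U AT AU; rewrite (PsiE _ (cstar_linear c AT AU)) (PsiE _ AT) (PsiE
    _ AU); exact: hl.
  - by move=> T U AT AU; rewrite (PsiE _ (cstar_mul AT AU)) (PsiE _ AT) (PsiE _ AU);
    exact: hm.
  - by move=> T U AT AU adj; rewrite (PsiE _ AT) (PsiE _ AU); exact: ha.
split.
- move=> _ [T AT <-]; rewrite /= (PsiE _ AT); exact: graph_closurer (factor_mapP AT).
- move=> C D; rewrite !inE => -[T AT <-] [U AU <-];
  rewrite (PsiE _ AT) (PsiE _ AU) => e.
  exact: (ideal_cosetP AT AU).2.
- move=> T' BT'; have [T h] := graph_closure_surj a BT'.
  have AT := graph_closurel h.
  by exists (ideal_coset I T); [exists T|rewrite (PsiE _ AT); exact: factor_mapE].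
Qed.
End FactorMap.

(** * Displacement by averages *)

Section Averaging.
Variables (R : realType) (G : groupType) (S : choiceType) (a : left_action G S).
Local Notation nrm := ell2_norm.

(** For the indicator m_i of a set V_i, the last condition says that V_i is
    disjoint from its image under g_i^-1 k g_i, and the one before it that a
    random V_i contains any given point with probability at least 1 - e. *)
Definition averaging_displacement : Prop :=
  forall (F : seq G) (e : R), (forall k, k \in F -> k <> 1%g) -> 0 < e ->
  exists n (t : 'I_n -> R) (g : 'I_n -> G) (m : 'I_n -> S -> R),
    [/\ forall i, 0 <= t i, \sum_i t i = 1, forall i s, 0 <= m i s <= 1,
        forall s, 1 - e <= \sum_i t i * m i s &
        forall k i s, k \in F -> m i s + m i (a ((g i)^-1 * k * g i)%g s) <= 1].

Lemma ell2_norm_pointwise_le (f g : ell2 R S) :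
  (forall s, Normc.normc (f s) <= Normc.normc (g s)) -> nrm f <= nrm g.
Proof.
move=> fg; rewrite -(@ler_pXn2r _ 2)// ?nnegrE ?ell2_norm_ge0//.
apply: ell2_norm_le => X; apply: le_trans (sum_norm_le g X).
by apply: ler_sum => s _; rewrite ler_pXn2r ?nnegrE ?normc_ge0.
Qed.

(** Let y be the average of the vectors pi(k_i) x. Then ||y||^2 is the average of
    the <pi(k_i) x, y>, each of which is split along y = (1 - m_i) y + m_i y. The
    first part is small on average since 1 - m_i is. In the second part m_i is
    moved onto pi(k_i) x, and then to x as the function m_i (k_i s), which is at
    most 1 - m_i (s). *)
Lemma averaged_norm_le n (t : 'I_n -> R) (k : 'I_n -> G) (m : 'I_n -> S -> R)
    (e : R) (x : ell2 R S) :
  (forall i, 0 <= t i) -> \sum_i t i = 1 -> (forall i s, 0 <= m i s <= 1) -> 0 <= e ->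
  (forall s, 1 - e <= \sum_i t i * m i s) ->
    (forall i s, m i s + m i (a (k i) s) <= 1) ->
  nrm (\sum_i (t i)%:C%C *: perm_rep a (k i) x) <= 2 * Num.sqrt e * nrm x.
Proof.
move=> t0 t1 m01 e0 me mk; set y := \sum_i _.
have u01 i s : 0 <= 1 - m i s <= 1.
  by have /andP[m0 m1] := m01 i s; rewrite subr_ge0 m1 /= gerBl.
have ue s : \sum_i t i * (1 - m i s) <= e.
  under eq_bigr do rewrite mulrBr mulr1.
  by rewrite sumrB t1 lerBlDr addrC -lerBlDr.
have /choice[hy hyP] : forall i, exists h, multiplied (fun s => 1 - m i s) y h.
  by move=> i; have [h []] := multiplied_ex y (u01 i); exists h.
have /choice[hx hxP] : forall i, exists h, multiplied (fun s => 1 - m i s) x h.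
  by move=> i; have [h []] := multiplied_ex x (u01 i); exists h.
have Hy := average_multiplied t0 t1 u01 e0 ue hyP.
have Hx := average_multiplied t0 t1 u01 e0 ue hxP.
have term i : Normc.normc (inner (perm_rep a (k i) x) y) <= nrm x * nrm (hy i) + nrm
  (hx i) * nrm y.
  have [p [pP _]] := multiplied_ex (perm_rep a (k i) x) (m01 i).
  have qP : multiplied (m i) y (y - hy i).
    by move=> s; rewrite ell2D ell2N hyP realCB mulrBl mul1r opprB addrCA subrr addr0.
  have -> : inner (perm_rep a (k i) x) y = inner (perm_rep a (k i) x) (hy i) + inner
    p y.
    by rewrite (multiplied_adj pP qP) innerBr addrCA subrr addr0.
  apply: le_trans (le_normcD _ _) _; apply: lerD.
    by apply: le_trans (ell2_cauchy_schwarz _ _) _; rewrite perm_rep_norm.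
  apply: le_trans (ell2_cauchy_schwarz _ _) _; rewrite ler_wpM2r ?ell2_norm_ge0//.
  rewrite -(perm_rep_norm a (k i)^-1%g); apply: ell2_norm_pointwise_le => s.
  rewrite perm_repE invgK pP perm_repE hxP -act_mul mulVg act_one !Normc.normcM
    !normc_real.
  rewrite ler_wpM2r ?normc_ge0// !ger0_norm; first by have := mk i s; lra.
    by have /andP[] := u01 i s.
  by have /andP[] := m01 i (a (k i) s).
have [/eqP ->|y0] := boolP (nrm y == 0).
  by rewrite !mulr_ge0 ?sqrtr_ge0 ?ell2_norm_ge0.
have yp : 0 < nrm y by rewrite lt_neqAle eq_sym y0 ell2_norm_ge0.
rewrite -(ler_pM2r yp) -expr2.
have yy : (nrm y ^+ 2)%:C%C = \sum_i (t i)%:C%C * inner (perm_rep a (k i) x) y.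
  rewrite -inner_self {1}/y; elim/big_rec2 : _ => [|i z w _ IH];
    first by rewrite inner0l.
  by rewrite innerDl innerZl IH.
have -> : nrm y ^+ 2 = Normc.normc (\sum_i (t i)%:C%C * inner (perm_rep a (k i) x) y).
  by rewrite -yy normc_real ger0_norm// sqr_ge0.
apply: (@le_trans _ _ (\sum_i t i * (nrm x * nrm (hy i) + nrm (hx i) * nrm y))).
  elim/big_rec2 : _ => [|i z w _ IH]; first by rewrite Normc.normc0.
  apply: le_trans (le_normcD _ _) _; apply: lerD => //.
  by rewrite Normc.normcM normc_real ger0_norm// ler_wpM2l.
have -> : \sum_i t i * (nrm x * nrm (hy i) + nrm (hx i) * nrm y) =
    nrm x * (\sum_i t i * nrm (hy i)) + (\sum_i t i * nrm (hx i)) * nrm y.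
  by rewrite mulr_sumr mulr_suml -big_split /=; apply: eq_bigr => i _; ring.
have hx0 := ell2_norm_ge0 x; have hy0 := ell2_norm_ge0 y.
apply: le_trans (lerD (ler_wpM2l hx0 Hy) (ler_wpM2r hy0 Hx)) _.
by rewrite le_eqVlt; apply/orP; left; apply/eqP; ring.
Qed.

Hypothesis avg : averaging_displacement.
Variable s0 : S.

(** If g_i^-1 k g_i fixes s0 then m_i (s0) <= 1 / 2, and not all m_i (s0) can be so
    small; the point sought is g_i s0. *)
Lemma displaced_point (F : seq G) : (forall k, k \in F -> k <> 1%g) ->
  exists s, forall k, k \in F -> a k s <> s.
Proof.
move=> F1; have [n [t [g [m [t0 t1 m01 me mk]]]]] :=
  avg F1 (divr_gt0 ltr01 (ltr0Sn _ 2)).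
have [i mi] : exists i, 1 / 2 < m i s0.
  apply: contrapT => /forallNP h.
  have : \sum_i t i * m i s0 <= \sum_i t i * (1 / 2).
    apply: ler_sum => i _; rewrite ler_wpM2l// leNgt; exact/negP.
  by rewrite -mulr_suml t1; have := me s0; lra.
exists (a (g i) s0) => k kF ks.
have := mk k i s0 kF; rewrite !act_mul ks -act_mul mulVg act_one; lra.
Qed.

Local Notation lam := (left_mul G).

Lemma point_vectorE (V : choiceType) (b : left_action G V) (v : V) w :
  rep b w (delta R v) = \sum_(p <- w) p.1 *: delta R (b p.2 v).
Proof. by apply: eq_bigr => p _; rewrite perm_rep_delta. Qed.

Lemma rep_delta_norm_sqr (V : choiceType) (b : left_action G V) (v : V) w :
  ((nrm (rep b w (delta R v)) ^+ 2)%:C%C =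
  \sum_(p <- w) \sum_(q <- w) p.1 * (q.1)^*%C * (b q.2 v == b p.2 v)%:R :> R[i]).
Proof.
rewrite -inner_self [in X in inner X _]point_vectorE.
elim/big_rec2 : _ => [|p z x _ <-]; first by rewrite inner0l.
rewrite innerDl innerZl; congr (_ + _); rewrite point_vectorE.
rewrite -[RHS](_ : p.1 * \sum_(q <- w) q.1^*%C * (b q.2 v == b p.2 v)%:R = _);
  last first.
  by rewrite mulr_sumr; apply: eq_bigr => q _; rewrite mulrA.
congr (_ * _); elim/big_rec2 : _ => [|q c y _ IH]; first by rewrite inner0r.
by rewrite innerDr innerZr inner_delta deltaE IH.
Qed.

(** The norm of a combination of the basis vectors at p s depends only on which of
    these points coincide. *)
Lemma transport_norm (w : seq (R[i] * G)) (s : S) :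
  (forall p q, p \in w -> q \in w -> p.2 <> q.2 -> a (p.2^-1 * q.2)%g s <> s) ->
  nrm (rep a w (delta R s)) = nrm (rep lam w (delta R (1%g : G))).
Proof.
move=> h; apply: (@pexpIrn _ 2) => //; rewrite ?nnegrE ?ell2_norm_ge0//.
apply: realC_inj; rewrite !rep_delta_norm_sqr big_seq [RHS]big_seq;
  apply: eq_bigr => p pw.
rewrite big_seq [RHS]big_seq; apply: eq_bigr => q qw; congr (_ * (nat_of_bool _)%:R).
rewrite /= !mulg1; apply/eqP/eqP => [e|->//].
apply: contrapT => pq; apply: (h q p qw pw pq).
by rewrite act_mul -e -act_mul mulVg act_one.
Qed.

(** On finitely supported vectors, [transport_norm] turns the inequality for lam
    into the one for a; such vectors are dense. *)
Lemma displacement_weak_containment : weakly_contains R a lam.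
Proof.
move=> u M M0 hu.
have fin w : nrm (rep lam u (rep lam w (delta R (1%g :
  G)))) <= M * nrm (rep lam w (delta R (1%g : G))).
  (* h |-> h s is to be injective on the supports of w and of u w *)
  pose W := fmul u w ++ w.
  pose F := [seq k <- [seq (p.2^-1 * q.2)%g | p <- W, q <- W] | k != 1%g].
  have [|s sP] := @displaced_point F.
    by move=> k; rewrite mem_filter => /andP[/eqP].
  have dis p q : p \in W -> q \in W -> p.2 <> q.2 -> a (p.2^-1 * q.2)%g s <> s.
    move=> pW qW pq; apply: sP; rewrite mem_filter; apply/andP; split.
      by apply/eqP => e; apply: pq; rewrite -[RHS]mul1g -(mulgV p.2) -mulgA e mulg1.
    by apply/allpairsP; exists (p, q).
  have e1 : nrm (rep a (fmul u w) (delta R s)) = nrm (rep lam (fmul u w) (delta R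
    (1%g : G))).
    by apply: transport_norm => p q pw qw; apply: dis; rewrite mem_cat ?pw ?qw.
  have e2 : nrm (rep a w (delta R s)) = nrm (rep lam w (delta R (1%g : G))).
    by apply: transport_norm => p q pw qw; apply: dis; rewrite mem_cat ?pw ?qw orbT.
  by move: e1; rewrite !rep_mul /= => <-; rewrite -e2; exact: hu.
move=> x; apply/ler_addgt0Pr => e e0.
pose K := coef_norm u + M + 1.
have K0 : 0 < K by rewrite ltr_wpDl// addr_ge0// sumr_ge0// => p _; exact: normc_ge0.
have [X hX] := finite_support_dense x (divr_gt0 e0 K0).
set z := \sum_(s <- X) _ in hX.
pose w : seq (R[i] * G) := [seq (x s, s) | s <- X].
have zE : z = rep lam w (delta R (1%g : G)).
  rewrite point_vectorE big_map; apply: eq_bigr => s _ /=; by rewrite mulg1.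
have h1 : nrm (rep lam u (x - z)) <= coef_norm u * (e / K).
  apply: le_trans (bounded_by_rep _ _ _) _; rewrite ler_wpM2l ?(ltW hX)//.
  by rewrite sumr_ge0// => p _; exact: normc_ge0.
have h2 : nrm z <= nrm x + e / K.
  rewrite -[z](subrK x) addrC; apply: le_trans (ell2_normD _ _) _.
  by rewrite lerD2l ell2_distC ltW.
have -> : rep lam u x = rep lam u (x - z) + rep lam u z.
  by rewrite (linear_opB _ _ (rep_linear _ _)) subrK.
apply: le_trans (ell2_normD _ _) _; apply: le_trans (lerD h1 (lexx _)) _.
have h3 : nrm (rep lam u z) <= M * (nrm x + e / K).
  by rewrite zE; apply: le_trans (fin w) _; rewrite -zE ler_wpM2l.
apply: le_trans (lerD (lexx _) h3) _; rewrite mulrDr addrCA lerD2l -mulrDl.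
rewrite mulrCA ler_piMr ?(ltW e0)// ler_pdivrMr// mul1r /K; lra.
Qed.
End Averaging.

(** * Proper closed ideals *)

Section IdealVanishing.
Variables (R : realType) (G : groupType) (S : choiceType) (a : left_action G S).
Local Notation nrm := ell2_norm.
Local Notation lam := (left_mul G).
Local Notation A := (cstar_rep (perm_rep (R := R) a)).
Hypothesis avg : averaging_displacement R a.
Variable J : set (operator R S).
Hypothesis properJ : proper_closed_ideal A J.

Let idealJ : closed_ideal A J := properJ.1.

Lemma idealB T U : J T -> J U -> J (T - U).
Proof.
move=> JT JU; have := closed_ideal_linear idealJ (-1) JU JT.
by rewrite scaleN1r addrC.
Qed.

Lemma idealD T U : J T -> J U -> J (T + U).
Proof. by move=> JT JU; have := closed_ideal_linear idealJ 1 JT JU;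
  rewrite scale1r. Qed.

Lemma idealZ c T : J T -> J (c *: T).
Proof.
by move=> JT; have := closed_ideal_linear idealJ c JT (closed_ideal0 idealJ);
  rewrite addr0.
Qed.

Lemma ideal_sum n (F : 'I_n -> operator R S) : (forall i, J (F i)) -> J (\sum_i F i).
Proof.
move=> JF; elim/big_ind : _ => //; first exact: (closed_ideal0 idealJ).
exact: idealD.
Qed.

Lemma cstar_perm g : A (perm_rep a g).
Proof. by rewrite -rep1; exact: cstar_rep_rep. Qed.

(** If 1 - j has norm less than 1, then the elements 1 - (1 - j)^n of J converge
    to 1, so that J is not proper. *)
Lemma ideal_far_from_id (j : operator R S) (r : R) :
  J j -> r < 1 -> ~ bounded_by r (idfun - j : operator R S).
Proof.
move=> Jj r1 hr; apply: properJ.2.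
have bJ : J `<=` @bounded_operator R S.
  by move=> T /(closed_ideal_sub idealJ) /cstar_repP[].
pose q := Num.max r 0.
have q0 : 0 <= q by rewrite le_max lexx orbT.
have q1 : q < 1 by rewrite gt_max r1 ltr01.
have hq : bounded_by q (idfun - j : operator R S) by apply: bounded_by_le hr;
  rewrite le_max lexx.
have [lj _] := bJ _ Jj.
have approx n : exists e, J e /\ bounded_by (q ^+ n) (idfun - e : operator R S).
  elim: n => [|n [e [Je he]]].
    exists 0; split; first exact: (closed_ideal0 idealJ).
    by rewrite subr0 expr0 => x; rewrite mul1r; exact: lexx.
  exists (e + (j - (j \o e))); split.
    apply: idealD => //; apply: idealB => //.
    by apply: (closed_ideal_mull idealJ) => //; exact: (closed_ideal_sub idealJ).
  have -> : idfun - (e + (j - (j \o e))) = (idfun - j : operator R S) \o (idfun - e).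
    apply/funext => x; transitivity (x - (e x + (j x - j (e x)))) => //.
    transitivity ((x - e x) - j (x - e x)) => //.
    by rewrite (linear_opB _ _ lj) opprD !opprB addrA.
  by rewrite exprS; exact: bounded_byM.
have Jid : J idfun.
  apply: (closed_ideal_closed idealJ); apply/(norm_closureP _ bJ); split.
    split; first by move=> c x y.
    by exists 1 => x; rewrite mul1r; exact: lexx.
  move=> e e0; have [n hn] : exists n, q ^+ n <= e.
    have qn : `|q| < 1 by rewrite ger0_norm.
    have /cvgrPdist_le /(_ e e0) [n _ /(_ n (leqnn n)) /=] := cvg_expr qn.
    by rewrite sub0r normrN => h; exists n; apply: le_trans h; exact: ler_norm.
  have [U [JU hU]] := approx n; exists U => //; exact: bounded_by_le hn hU.
apply/seteqP; split; first exact: (closed_ideal_sub idealJ).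
by move=> T AT; exact: (closed_ideal_mull idealJ AT Jid).
Qed.

(** The left-hand side is the trace of T', and c is that of an approximation u of T
    in the group ring. Averaging the conjugates of T by the g_i keeps it in J; it
    fixes the term c of u and makes the other terms small. So, if c were not
    small, J would contain an element close to a non-zero scalar. *)
Lemma ideal_trace0 T T' : graph_closure a lam T T' -> J T ->
  T' (delta R (1%g : G)) 1%g = 0.
Proof.
move=> [bT bT' hT] JT; apply: Normc.eq0_normc; apply/eqP; rewrite eq_le normc_ge0 andbT.
apply/ler_addgt0Pl => e e0; rewrite addr0; pose d := e / 3.
have d0 : 0 < d by rewrite divr_gt0.
have [u [hu hu']] := hT d d0.
pose c := rep lam u (delta R (1%g : G)) 1%g.
have cE : c = \sum_(p <- u | p.2 == 1%g) p.1.
  rewrite /c -inner_delta point_vectorE [RHS]big_mkcond /=.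
  elim/big_rec2 : _ => [|p y x _ IH]; first by rewrite inner0l.
  rewrite innerDl IH innerZl inner_delta deltaE /= mulg1 eq_sym.
  by case: eqP; rewrite ?mulr1 ?mulr0.
have h1 : Normc.normc (T' (delta R (1%g : G)) 1%g - c) <= d.
  have -> : T' (delta R (1%g : G)) 1%g - c = (T' - rep lam u) (delta R (1%g :
    G)) 1%g by [].
  apply: le_trans (ell2_coord_le _ _) _; apply: le_trans (hu' _) _.
  by rewrite ell2_norm_delta mulr1.
suff h2 : Normc.normc c <= 2 * d.
  rewrite -[T' _ _](subrK c); apply: le_trans (le_normcD _ _) _.
  by apply: le_trans (lerD h1 h2) _; rewrite /d; lra.
rewrite leNgt; apply/negP => hc.
have c0 : 0 < Normc.normc c by apply: lt_trans hc; rewrite mulr_gt0.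
pose K := coef_norm u; have K0 : 0 <= K by rewrite sumr_ge0// => p _; exact: normc_ge0.
(* chosen so that the terms of u other than c contribute at most 2 r K <= d *)
pose r := d / (2 * (K + 1)).
have r0 : 0 < r by rewrite divr_gt0// mulr_gt0// ltr_wpDl.
pose F := [seq k <- [seq p.2 | p <- u] | k != 1%g].
have [|n [t [g [m [t0 t1 m01 me mk]]]]] := @avg F (r ^+ 2) _ (exprn_gt0 2 r0).
  by move=> k; rewrite mem_filter => /andP[/eqP].
pose av (V : operator R S) : operator R S :=
  \sum_i (t i)%:C%C *: (perm_rep a (g i)^-1%g \o (V \o perm_rep a (g i))).
have avE V x : av V x = \sum_i (t i)%:C%C *: perm_rep a (g i)^-1%g (V (perm_rep a (g
  i) x)).
  by rewrite /av fct_sumE.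
have Jav : J (av T).
  apply: ideal_sum => i; apply: idealZ; apply: (closed_ideal_mull idealJ);
    first exact: cstar_perm.
  by apply: (closed_ideal_mulr idealJ) => //; exact: cstar_perm.
have hav : bounded_by d (av T - av (rep a u)).
  move=> x; rewrite operatorB !avE -sumrB; apply: le_trans (ell2_norm_sum _ _ _) _.
  rewrite -[leRHS]mul1r -t1 mulr_suml; apply: ler_sum => i _.
  rewrite -scalerBr ell2_normZ normc_real ger0_norm// ler_wpM2l//.
  rewrite -(linear_opB _ _ (@perm_rep_linear R G S a _)) perm_rep_norm.
  by apply: le_trans (hu _) _; rewrite perm_rep_norm.
have hrep x : av (rep a u) x = c *: x +
    \sum_(p <- u | p.2 != 1%g) p.1 *: \sum_i (t i)%:C%C *: perm_rep a ((g i)^-1 * p.2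
      * g i)%g x.
  transitivity (\sum_(p <- u) p.1 *: \sum_i (t i)%:C%C *: perm_rep a ((g i)^-1 * p.2
    * g i)%g x).
    rewrite avE; under [RHS]eq_bigr do rewrite scaler_sumr.
    rewrite exchange_big /=; apply: eq_bigr => i _.
    rewrite /rep (linear_opsum _ _ (@perm_rep_linear R G S a _)) scaler_sumr.
    apply: eq_bigr => p _; rewrite (linear_opZ _ _ (@perm_rep_linear R G S a _)).
    by rewrite !perm_repM !scalerA mulrC.
  rewrite (bigID (fun p => p.2 == 1%g)) /=; congr (_ + _).
  rewrite cE scaler_suml; apply: eq_bigr => p /eqP ->; congr (_ *: _).
  under eq_bigr do rewrite mulg1 mulVg perm_rep1.
  by rewrite -scaler_suml -rmorph_sum t1 scale1r.
have hid : bounded_by (d + d) (av T - c *: (idfun : operator R S)).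
  apply: bounded_by_dist3 hav _ => x; rewrite operatorB hrep operatorZ /= addrAC
    subrr add0r.
  apply: le_trans (ell2_norm_sum _ _ _) _.
  apply: (@le_trans _ _ (\sum_(p <- u) Normc.normc p.1 * (2 * r * nrm x))).
    rewrite big_seq_cond [leRHS]big_seq [leRHS](bigID (fun p => p.2 != 1%g)) /=.
    rewrite -[leLHS]addr0; apply: lerD; last first.
      by apply: sumr_ge0 => p _; rewrite mulr_ge0 ?normc_ge0//
        mulr_ge0 ?ell2_norm_ge0// mulr_ge0// ltW.
    apply: ler_sum => p /andP[pu p1]; rewrite ell2_normZ ler_wpM2l ?normc_ge0//.
    have -> : r = Num.sqrt (r ^+ 2) by rewrite sqrtr_sqr ger0_norm// ltW.
    apply: (@averaged_norm_le _ _ _ _ _ _ _ m) => //; first exact: sqr_ge0.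
    by move=> i s; apply: mk; rewrite mem_filter p1; apply/mapP; exists p.
  rewrite -mulr_suml -/(coef_norm u) -/K mulrA ler_wpM2r ?ell2_norm_ge0// /r.
  rewrite (_ : K * (2 * (d / (2 * (K + 1)))) = d * (K / (K + 1))).
    by rewrite ler_piMr ?(ltW d0)// ler_pdivrMr ?mul1r ?lerDl// ltr_wpDl.
  by field; rewrite gt_eqF// ltr_wpDl.
apply: (@ideal_far_from_id (c^-1 *: av T) ((Normc.normc c)^-1 * (2 * d))).
- exact: idealZ.
- by rewrite mulrC ltr_pdivrMr// mul1r.
- have cn0 : c != 0 by apply: contraTneq c0 => ->; rewrite Normc.normc0 ltxx.
  have := bounded_byZ c^-1 (bounded_by_distC hid).
  rewrite Normc.normcV scalerBr scalerA mulVf// scale1r.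
  by apply: bounded_by_le; rewrite ler_wpM2l ?invr_ge0 ?normc_ge0//; lra.
Qed.

(** The matrix coefficient of T' at (k, l) is the trace of the translate of T' by
    l^-1 and k, which comes from an element of J as well. *)
Lemma ideal_regular0 T T' : graph_closure a lam T T' -> J T -> T' = 0.
Proof.
move=> h JT.
have hp g : graph_closure a lam (perm_rep (R := R) a g) (perm_rep lam g).
  by rewrite -!rep1; exact: graph_closure_rep.
have coef (k l : G) : T' (delta R k) l = 0.
  have Jc : J (perm_rep a l^-1%g \o (T \o perm_rep a k)).
    apply: (closed_ideal_mull idealJ); first exact: cstar_perm.
    by apply: (closed_ideal_mulr idealJ) => //; exact: cstar_perm.
  have hc : graph_closure a lam (perm_rep a l^-1%g \o (T \o perm_rep a k))
     (perm_rep lam l^-1%g \o (T' \o perm_rep lam k)).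
    exact: graph_closure_mul (hp _) (graph_closure_mul h (hp _)).
  have := ideal_trace0 hc Jc; rewrite /= perm_rep_delta /= invgK !mulg1.
  by [].
have [_ /bounded_operatorP[lT [M [M0 hM]]] _] := h.
have T'd k : T' (delta R k) = 0 by apply: ell2_ext => l; exact: coef.
apply/funext => x; apply: ell2_norm_eq0; apply/eqP; rewrite eq_le ell2_norm_ge0 andbT.
apply/ler_addgt0Pl => e e0; rewrite addr0.
have [X hX] := finite_support_dense x (divr_gt0 e0 M0).
have -> : T' x = T' (x - \sum_(s <- X) x s *: delta R s).
  rewrite (linear_opB _ _ lT) (linear_opsum _ _ lT) big1 ?subr0// => s _.
  by rewrite (linear_opZ _ _ lT) T'd scaler0.
by apply: le_trans (hM _) _; rewrite mulrC -ler_pdivlMr// ltW.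
Qed.
End IdealVanishing.

(** The displacement property alone yields all the conclusions, for any
    permutation representation. *)
Theorem displacement_factorization (R : realType) (G : groupType) (S : choiceType)
    (a : left_action G S) (s0 : S) (avg : averaging_displacement R a) :
  exists Phi : operator R S -> operator R G,
    let A := cstar_rep (perm_rep a) in
    let I := star_hom_kernel A Phi in
    [/\ star_hom A Phi,
        forall g, Phi (perm_rep a g) = left_regular R G g,
        quotient_isomorphic A I (cstar_rep (left_regular R G)),
        proper_closed_ideal A I &
        forall J : set (operator R S), proper_closed_ideal A J -> J `<=` I].
Proof.
have wcont := displacement_weak_containment avg s0.
exists (factor_map a (left_mul G)) => /=; split.
- exact: star_hom_factor_map.
- by move=> g; exact: factor_map_perm.
- exact: quotient_isomorphic_factor_map.
- exact: (proper_closed_ideal_kernel wcont (1%g : G)).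
- move=> J properJ T JT; have AT := closed_ideal_sub properJ.1 JT.
  by split => //=; exact: (ideal_regular0 avg properJ (factor_mapP wcont AT) JT).
Qed.

(** * A minimax theorem for finitely additive probabilities *)

Section FinitelyAdditive.
Variables (R : realType) (X : Type).

Definition finitely_additive_probability (m : set X -> R) : Prop :=
  [/\ m setT = 1, forall A, 0 <= m A &
      forall A B, A `&` B = set0 -> m (A `|` B) = m A + m B].

Variables (I : Type) (U : I -> set X) (c : R).

(** Convex cones of functions that are to become non-negative for a mean m: they
    contain the non-negative functions and impose m (U i) <= c; excluding the
    constant -1 keeps m (X) positive. *)
Definition proper_cone (C : set (X -> R)) : Prop :=
  [/\ forall h, (forall x, 0 <= h x) -> C h,
      forall i, C (fun x => c - \1_(U i) x),
      forall h k, C h -> C k -> C (fun x => h x + k x),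
      forall (l : R) h, 0 < l -> C h -> C (fun x => l * h x) &
      ~ C (fun=> -1)].

(** Zorn's lemma. If h is not in a maximal cone C, then the cone generated by C and
    h contains -1 = f + l h with f in C, and l > 0 because C is proper; hence
    - h = (f + 1) / l is in C. *)
Lemma maximal_proper_cone (C0 : set (X -> R)) : proper_cone C0 ->
  exists C, proper_cone C /\ forall h, ~ C h -> C (fun x => - h x).
Proof.
move=> good0.
(* Joining C0 to the members of the chain makes the empty chain harmless. *)
have chain (F : set (set (X -> R))) : F `<=` (fun B => proper_cone (B `|` C0)) ->
    total_on F subset -> proper_cone ((\bigcup_(B in F) B) `|` C0).
  move=> FP Ftot; have [n0 u0 a0 s0 p0] := good0.
  have lift h : (exists B, F B /\ (B `|` C0) h) -> ((\bigcup_(B in F) B) `|` C0) h.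
    by move=> [B [FB [Bh|]]]; [left; exists B|right].
  have one h k : ((\bigcup_(B in F) B) `|` C0) h -> ((\bigcup_(B in F) B) `|` C0) k ->
      (C0 h /\ C0 k) \/ exists B, [/\ F B, (B `|` C0) h & (B `|` C0) k].
    move=> [[B FB Bh]|hh] [[D FD Dk]|kk].
    - right; have [BD|DB] := Ftot _ _ FB FD.
        by exists D; split => //; left => //; exact: BD.
      by exists B; split => //; left => //; exact: DB.
    - by right; exists B; split => //; [left|right].
    - by right; exists D; split => //; [right|left].
    - by left.
  split.
  - by move=> h h0; right; exact: n0.
  - by move=> i; right; exact: u0.
  - move=> h k hh kk; have [[? ?]|[B [FB Bh Bk]]] := one h k hh kk.
      by right; exact: a0.
    by apply: lift; exists B; split => //; have [_ _ + _ _] := FP _ FB; apply.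
  - move=> l h l0 hh; have [[? _]|[B [FB Bh _]]] := one h h hh hh.
      by right; exact: s0.
    by apply: lift; exists B; split => //; have [_ _ _ + _] := FP _ FB; apply.
  - move=> hh; have [[? _]|[B [FB Bh _]]] := one _ _ hh hh; first exact: p0.
    by have [_ _ _ _] := FP _ FB; apply.
have [B [good Bmax]] := Zorn_bigcup chain.
pose C := B `|` C0; exists C; split => // h hC.
have [nC uC aC sC pC] := good.
pose D : set (X -> R) := [set k | exists f (l : R), [/\ C f, 0 <= l & k = (fun x =>
  f x + l * h x)]].
have CD : C `<=` D.
  by move=> f Cf; exists f, 0; split => //; apply/funext => x; rewrite mul0r addr0.
have Dh : D h.
  exists (fun=> 0), 1; split => //; first exact: nC.
  by apply/funext => x; rewrite mul1r add0r.
have : D (fun=> -1).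
  apply: contrapT => nD; apply: (Bmax D).
    split; first by move=> f Bf; apply: CD; left.
    by move=> DB; apply: hC; left; exact: DB.
  have -> : D `|` C0 = D by apply/setUidl => f C0f; apply: CD; right.
  split.
  - by move=> f f0; apply: CD; exact: nC.
  - by move=> i; apply: CD; exact: uC.
  - move=> _ _ [f [l [Cf l0 ->]]] [f' [l' [Cf' l0' ->]]].
    exists (fun x => f x + f' x), (l + l'); split; [exact: aC|exact: addr_ge0|].
    by apply/funext => x; ring.
  - move=> r _ r0 [f [l [Cf l0 ->]]]; exists (fun x => r * f x), (r * l); split.
    + exact: sC.
    + by rewrite mulr_ge0// ltW.
    + by apply/funext => x; ring.
  - exact: nD.
move=> [f [l [Cf l0 e]]].
have lp : 0 < l.
  rewrite lt_neqAle l0 andbT eq_sym; apply/negP => /eqP l00; apply: pC.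
  by rewrite e l00; rewrite (_ : (fun x => _) = f)//; apply/funext => x;
    rewrite mul0r addr0.
rewrite (_ : (fun x => - h x) = (fun x => l^-1 * (f x + 1))); last first.
  apply/funext => x; have := congr1 (@^~ x) e => /= e1.
  rewrite (_ : f x = -1 - l * h x); last by rewrite e1; ring.
  by field; rewrite gt_eqF.
apply: sC; first by rewrite invr_gt0.
by apply: aC => //; apply: nC.
Qed.

(** m (A) is the cut between the s with 1_A - s in C and those with s - 1_A in C. *)
Lemma proper_cone_probability (C : set (X -> R)) : proper_cone C ->
  (forall h, ~ C h -> C (fun x => - h x)) ->
  exists m, finitely_additive_probability m /\ forall i, m (U i) <= c.
Proof.
move=> [nC uC aC sC pC] tot.
have addC h k f : C h -> C k -> (forall x, f x = h x + k x) -> C f.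
  by move=> Ch Ck /funext ->; exact: aC.
have cst (r : R) h : C h -> (forall x, h x = r) -> 0 <= r.
  move=> Ch /funext hr; rewrite leNgt; apply/negP => r0; apply: pC.
  rewrite (_ : (fun=> -1) = (fun x => (- r)^-1 * h x)).
    by apply: sC => //; rewrite invr_gt0 oppr_gt0.
  by apply/funext => x; rewrite hr; field; rewrite lt_eqF.
pose Q (A : set X) : set R := [set s | C (fun x => \1_A x - s)].
have i01 (A : set X) x : 0 <= (\1_A x : R) <= 1.
  by rewrite indicE; case: (x \in A); rewrite /= ?lexx ?ler01.
have Q0 A : Q A 0.
  by apply: nC => x; rewrite subr0; case/andP: (i01 A x).
have Qub A s : Q A s -> s <= 1.
  move=> Qs; rewrite -subr_ge0; apply: (cst _ (fun x => (\1_A x - s) + (1 - \1_A x))).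
    by apply: aC => //; apply: nC => x; rewrite subr_ge0; case/andP: (i01 A x).
  by move=> x; ring.
have hsQ A : has_sup (Q A).
  by split; [exists 0|exists 1 => s; exact: Qub].
pose q A := sup (Q A).
have A1 A s : C (fun x => \1_A x - s) -> s <= q A.
  by move=> h; apply: ub_le_sup => //; case: (hsQ A).
have A2 A s : C (fun x => s - \1_A x) -> q A <= s.
  move=> h; apply: ge_sup; first by exists 0.
  move=> r Qr; rewrite -subr_ge0; apply: (cst _ _ (aC _ _ Qr h)) => x; ring.
have A3 A (e : R) : 0 < e -> C (fun x => \1_A x - (q A - e)).
  move=> e0; have [r Qr hr] := sup_adherent e0 (hsQ A).
  apply: (addC _ (fun=> r - (q A - e)) _ Qr); last by move=> x; ring.
  by apply: nC => _; rewrite subr_ge0 ltW.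
have A4 A (e : R) : 0 < e -> C (fun x => (q A + e) - \1_A x).
  move=> e0; have [h|h] := pselect (C (fun x => \1_A x - (q A + e))).
    by have := A1 _ _ h; rewrite gerDl leNgt e0.
  by have := tot _ h; congr C; apply/funext => x; ring.
exists q; split; last by move=> i; exact: A2.
split.
- apply/eqP; rewrite eq_le; apply/andP; split; [apply: A2|apply: A1];
    by apply: nC => x; rewrite indicE in_setT subrr.
- by move=> A; apply: A1; exact: Q0.
- move=> A B AB.
  have iU x : (\1_(A `|` B) x : R) = \1_A x + \1_B x.
    rewrite !indicE in_setU; case: (boolP (x \in A)); case: (boolP (x \in B)) => //=.
      rewrite !inE => Bx Ax; have : (A `&` B) x by [].
      by rewrite AB.
    by rewrite addr0.
    by rewrite add0r.
    by rewrite addr0.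
  apply/eqP; rewrite eq_le; apply/andP; split; apply/ler_addgt0Pr => e e0;
    have e2 : 0 < e / 2 by rewrite divr_gt0.
    apply: A2; apply: (addC _ _ _ (A4 A _ e2) (A4 B _ e2)) => x.
    by rewrite iU; field.
  rewrite -lerBlDr; apply: A1; apply: (addC _ _ _ (A3 A _ e2) (A3 B _ e2)) => x.
  by rewrite iU; field.
Qed.

(** The functions bounded below by a non-negative combination of the c - 1_(U i)
    form a cone, which is proper by the hypothesis on convex combinations. *)
Lemma finitely_additive_minimax (x0 : X) :
  (forall n (t : 'I_n -> R) (g : 'I_n -> I), (forall i, 0 <= t i) -> \sum_i t i = 1 ->
     exists x, \sum_i t i * \1_(U (g i)) x <= c) ->
  exists m, finitely_additive_probability m /\ forall i, m (U i) <= c.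
Proof.
move=> H.
pose C0 : set (X -> R) := [set h | exists n (t : 'I_n -> R) (g : 'I_n -> I),
  (forall i, 0 <= t i) /\ forall x, \sum_i t i * (c - \1_(U (g i)) x) <= h x].
have good0 : proper_cone C0.
  split.
  - move=> h h0; exists 0%N, (fun=> 0), (fun i : 'I_0 =>
    False_rect _ (notF (ltn_ord i))).
    by split => // x; rewrite big_ord0.
  - move=> i; exists 1%N, (fun=> 1), (fun=> i); split => // x.
    by rewrite big_ord1 mul1r.
  - move=> h k [n [t [g [t0 th]]]] [n' [t' [g' [t0' tk]]]].
    exists (n + n')%N, (fun i => match fintype.split i with inl j => t j | inr j =>
      t' j end),
      (fun i => match fintype.split i with inl j => g j | inr j => g' j end).
    split=> [i|x]; first by case: (fintype.split i).
    rewrite big_split_ord /=; apply: lerD.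
      apply: le_trans (th x); rewrite le_eqVlt; apply/orP; left; apply/eqP;
        apply: eq_bigr => i _.
      by rewrite (unsplitK (inl i)).
    apply: le_trans (tk x); rewrite le_eqVlt; apply/orP; left; apply/eqP;
      apply: eq_bigr => i _.
    by rewrite (unsplitK (inr i)).
  - move=> l h l0 [n [t [g [t0 th]]]]; exists n, (fun i => l * t i), g; split=> [i|x].
      by rewrite mulr_ge0// ltW.
    under eq_bigr do rewrite -mulrA.
    by rewrite -mulr_sumr ler_wpM2l// ltW.
  - move=> [n [t [g [t0 th]]]]; pose T := \sum_i t i.
    have T0 : 0 <= T by apply: sumr_ge0.
    have [/eqP T00|Tn0] := boolP (T == 0).
      have ti i : t i = 0.
        by move: T00 => /eqP; rewrite psumr_eq0// =>
          /allP /(_ i (mem_index_enum i)) /eqP.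
      by have := th x0; rewrite big1 => [|i _]; [rewrite ler0N1|rewrite ti mul0r].
    have Tp : 0 < T by rewrite lt_neqAle eq_sym Tn0.
    have [||x] := H n (fun i => T^-1 * t i) g.
    + by move=> i; rewrite mulr_ge0// invr_ge0.
    + by rewrite -mulr_sumr mulVf.
    + under eq_bigr do rewrite -mulrA.
      rewrite -mulr_sumr mulrC ler_pdivrMr// => h1.
      have := th x; under eq_bigr do rewrite mulrBr.
      rewrite sumrB -mulr_suml -/T; lra.
have [C [gC tC]] := maximal_proper_cone good0.
exact: proper_cone_probability gC tC.
Qed.
End FinitelyAdditive.

(** * Regular Borel probabilities from finitely additive ones *)

Section Regularization.
Variables (R : realType) (X : ptopologicalType) (m : set X -> R).
Hypothesis hm : finitely_additive_probability m.
Hypothesis cX : compact [set: X].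
Hypothesis hX : hausdorff_space X.

Lemma content_additive A B : A `&` B = set0 -> m (A `|` B) = m A + m B.
Proof. by case: hm => _ _; apply. Qed.

Lemma content_mono A B : A `<=` B -> m A <= m B.
Proof.
move=> AB; rewrite -(setDUK AB) content_additive ?setDIK// lerDl.
by case: hm.
Qed.

Lemma content0 : m set0 = 0.
Proof.
have := @content_additive set0 set0 (setI0 _); rewrite setU0 => h.
by apply: (@addrI _ (m set0)); rewrite -h addr0.
Qed.

Lemma content_le1 A : m A <= 1.
Proof. by case: hm => <- _ _; exact: content_mono. Qed.

(** The regularization of m: closed sets from inside give the value of an open set,
    open sets from outside give the value of any set. *)
Definition inner_content (U : set X) : R :=
  sup [set m K | K in [set K | closed K /\ K `<=` U]].
Definition outer_content (E : set X) : R :=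
  inf [set inner_content U | U in [set U | open U /\ E `<=` U]].

Lemma inner_content_has_sup U : has_sup [set m K | K in [set K | closed K /\ K `<=` U]].
Proof.
split; first by exists (m set0); exists set0 => //; split => //; exact: closed0.
by exists 1 => _ [K _ <-]; exact: content_le1.
Qed.

Lemma content_le_inner K U : closed K -> K `<=` U -> m K <= inner_content U.
Proof.
move=> cK KU; apply: ub_le_sup; first by case: (inner_content_has_sup U).
by exists K.
Qed.

Lemma inner_content_le U (r : R) :
  (forall K, closed K -> K `<=` U -> m K <= r) -> inner_content U <= r.
Proof.
move=> h; apply: ge_sup; first by case: (inner_content_has_sup U).
by move=> _ [K [cK KU] <-]; exact: h.
Qed.

Lemma inner_content_mono U V : U `<=` V -> inner_content U <= inner_content V.
Proof.
move=> UV; apply: inner_content_le => K cK KU; apply: content_le_inner => //.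
exact: subset_trans KU UV.
Qed.

Lemma inner_content_le_content U : inner_content U <= m U.
Proof. by apply: inner_content_le => K _; exact: content_mono. Qed.

Lemma inner_content_ge0 U : 0 <= inner_content U.
Proof. by rewrite -content0; apply: content_le_inner => //; exact: closed0. Qed.

Lemma content_subadditive A B : m (A `|` B) <= m A + m B.
Proof.
have -> : A `|` B = A `|` (B `\` A).
  apply/seteqP; split=> [x [Ax|Bx]|x [Ax|[Bx _]]]; [by left| |by left|by right].
  by have [Ax|nAx] := pselect (A x); [left|right].
rewrite content_additive ?setDIK// lerD2l; apply: content_mono; exact: subDsetl.
Qed.

(** By normality, a closed subset of the union of U and V is the union of a closed
    subset of U and a closed subset of V. *)
Lemma inner_content_subadditive U V : open U -> open V ->
  inner_content (U `|` V) <= inner_content U + inner_content V.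
Proof.
move=> oU oV; apply: inner_content_le => K cK KUV.
have cD : closed (K `\` V) by rewrite setDE; apply: closedI => //; exact: open_closedC.
have nU : set_nbhs (K `\` V) U.
  by apply/set_nbhsP; exists U; split => // x [Kx nVx]; have [|] := KUV _ Kx.
have [B /set_nbhsP[C [oC DC CB]] BU] := compact_normal hX cX cD nU.
have -> : K = (K `&` closure B) `|` (K `\` C).
  apply/seteqP; split=> [x Kx|x [[]//|[]//]].
  have [Cx|nCx] := pselect (C x); [left|right] => //; split => //.
  by apply: subset_closure; exact: CB.
apply: le_trans (content_subadditive _ _) _; apply: lerD; apply: content_le_inner.
- by apply: closedI => //; exact: closed_closure.
- by move=> x [_ /BU].
- by rewrite setDE; apply: closedI => //; exact: open_closedC.
- move=> x [Kx nCx]; apply: contrapT => nVx; apply: nCx; exact: DC.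
Qed.

Lemma inner_content_bigcup (U : nat -> set X) n : (forall i, open (U i)) ->
  inner_content (\bigcup_(i < n) U i) <= \sum_(i < n) inner_content (U i).
Proof.
move=> oU; elim: n => [|n IH].
  rewrite big_ord0 II0 bigcup_set0; apply: inner_content_le => K _.
  by rewrite subset0 => ->; rewrite content0.
rewrite big_ord_recr /= IIS bigcup_setU bigcup_set1.
apply: le_trans (inner_content_subadditive _ _) _ => //; first exact: bigcup_open.
by rewrite lerD2r.
Qed.

Lemma outer_content_has_inf E :
  has_inf [set inner_content U | U in [set U | open U /\ E `<=` U]].
Proof.
split; first by exists (inner_content setT); exists setT => //; split => //;
  exact: openT.
by exists 0 => _ [U _ <-]; exact: inner_content_ge0.
Qed.

Lemma outer_content_le_inner E U : open U -> E `<=` U ->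
  outer_content E <= inner_content U.
Proof.
move=> oU EU; apply: ge_inf; first by case: (outer_content_has_inf E).
by exists U.
Qed.

Lemma outer_content_ge E (r : R) : (forall U, open U -> E `<=` U ->
  r <= inner_content U) ->
  r <= outer_content E.
Proof.
move=> h; apply: lb_le_inf; first by case: (outer_content_has_inf E).
by move=> _ [U [oU EU] <-]; exact: h.
Qed.

Lemma outer_content_open U : open U -> outer_content U = inner_content U.
Proof.
move=> oU; apply/eqP; rewrite eq_le outer_content_le_inner//=.
by apply: outer_content_ge => V oV; exact: inner_content_mono.
Qed.

Lemma outer_content_ge0 E : 0 <= outer_content E.
Proof. by apply: outer_content_ge => U _ _; exact: inner_content_ge0. Qed.

Lemma outer_content_mono E F : E `<=` F -> outer_content E <= outer_content F.
Proof.
move=> EF; apply: outer_content_ge => U oU FU; apply: outer_content_le_inner => //.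
exact: subset_trans EF FU.
Qed.

Let mu (E : set X) : \bar R := (outer_content E)%:E.

Let mu0 : mu set0 = 0%E.
Proof.
rewrite /mu outer_content_open; last exact: open0.
congr EFin; apply/eqP; rewrite eq_le inner_content_ge0 andbT.
by rewrite -content0; exact: inner_content_le_content.
Qed.

Let mu_ge0 E : (0 <= mu E)%E.
Proof. by rewrite lee_fin outer_content_ge0. Qed.

Let mu_mono : {homo mu : A B / A `<=` B >-> (A <= B)%E}.
Proof. by move=> A B AB; rewrite lee_fin outer_content_mono. Qed.

Let mu_sub : measure_extension.sigma_subadditive mu.
Proof.
move=> F; apply/lee_addgt0Pr => e e0.
have /choice[U UP] : forall i, exists U, [/\ open U, F i `<=` U &
    inner_content U <= outer_content (F i) + e / (2 ^ i.+1)%:R].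
  move=> i; have ei : 0 < e / (2 ^ i.+1)%:R by rewrite divr_gt0// ltr0n expn_gt0.
  have [_ [U [oU FU] <-] hU] := inf_adherent ei (outer_content_has_inf (F i)).
  by exists U; split => //; exact: ltW.
have oU i : open (U i) by case: (UP i).
apply: (@le_trans _ _ (\sum_(0 <= i <oo) (mu (F i) + (e / (2 ^ i.+1)%:R)%:E))%E);
  last first.
  by apply: epsilon_trick => //; exact: ltW.
have : (mu (\bigcup_n F n) <= (inner_content (\bigcup_n U n))%:E)%E.
  rewrite lee_fin; apply: outer_content_le_inner; first exact: bigcup_open.
  by apply: subset_bigcup => i _; case: (UP i).
move/le_trans; apply.
set S := (\sum_(0 <= i <oo) _)%E.
have term_ge0 i : (0 <= mu (F i) + (e / (2 ^ i.+1)%:R)%:E)%E.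
  by rewrite adde_ge0// lee_fin divr_ge0// ltW.
have bound K : closed K -> K `<=` \bigcup_n U n -> ((m K)%:E <= S)%E.
  move=> cK KU.
  (* K meets only finitely many of the U i. *)
  have cmK : compact K by apply: (subclosed_compact cK cX).
  move: cmK; rewrite compact_cover => /(_ nat setT U (fun i _ => oU i) KU)[D _ KD].
  pose n := (\max_(i <- enum_fset D) i).+1.
  have Kn : K `<=` \bigcup_(i < n) U i.
    move=> x /KD[i /= iD Uix]; exists i => //=.
    by rewrite ltnS; exact: (@leq_bigmax_seq _ _ predT id).
  apply: (@le_trans _ _ (\sum_(0 <= i < n) (mu (F i) + (e / (2 ^ i.+1)%:R)%:E))%E);
    last first.
    by apply: nneseries_lim_ge => i _ _.
  rewrite big_mkord (eq_bigr (fun i : 'I_n =>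
    (outer_content (F i) + e / (2 ^ i.+1)%:R)%:E))//.
  rewrite sumEFin lee_fin.
  apply: le_trans (content_le_inner cK Kn) _;
    apply: le_trans (inner_content_bigcup _ oU) _.
  by apply: ler_sum => i _; case: (UP i).
case ES : S => [s| |].
- rewrite lee_fin; apply: inner_content_le => K cK KU.
  by rewrite -lee_fin -ES; exact: bound.
- by rewrite leey.
- by have := bound set0 closed0 (sub0set _); rewrite ES.
Qed.

Let outer_mu : {outer_measure set X -> \bar R} :=
  HB.pack mu (isOuterMeasure.Build R X mu mu0 mu_ge0 mu_mono mu_sub).

Let open_caratheodory U : open U -> outer_mu.-caratheodory U.
Proof.
move=> oU; apply: le_caratheodory_measurable => Y.
rewrite /= /mu -EFinD lee_fin; apply: outer_content_ge => V oV YV.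
rewrite -lerBrDr; apply: (@le_trans _ _ (inner_content (V `&` U))).
  by apply: outer_content_le_inner; [exact: openI|exact: setSI].
apply: inner_content_le => K cK KVU; rewrite lerBrDl -lerBrDr.
apply: (@le_trans _ _ (inner_content (V `&` ~` K))).
  apply: outer_content_le_inner; first by apply: openI => //; exact: closed_openC.
  by move=> x [Yx nUx]; split; [exact: YV|move=> /KVU[]].
apply: inner_content_le => L cL LVK; rewrite lerBrDr -content_additive.
  apply: content_le_inner; first exact: closedU.
  by move=> x [/LVK[]|/KVU[]].
by apply/seteqP; split => // x [/LVK[]].
Qed.

Let borel_caratheodory (A : set (borel X)) : measurable A -> outer_mu.-caratheodory A.
Proof.
move: A; apply: smallest_sub; last exact: open_caratheodory.
exact: (@sigma_algebra_measurable _ (caratheodory_type outer_mu)).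
Qed.

(** On Borel sets the outer measure is a measure, as open sets satisfy the
    criterion of Caratheodory. *)
Definition regularization (A : set (borel X)) : \bar R := (outer_content A)%:E.

Local Notation nu := regularization.

Let nu_sigma_additive : semi_sigma_additive nu.
Proof.
move=> F mF tF mUF.
apply: (@caratheodory_measure_sigma_additive _ _ outer_mu) => //;
  last exact: borel_caratheodory.
by move=> i; exact: borel_caratheodory.
Qed.

Let nuT : nu setT = 1%E.
Proof.
rewrite /regularization outer_content_open; last exact: openT.
congr EFin; apply/eqP; rewrite eq_le; apply/andP; split.
  by apply: inner_content_le => K _ _; exact: content_le1.
by case: hm => <- _ _; apply: content_le_inner => //; exact: closedT.
Qed.

HB.instance Definition _ :=
  isMeasure.Build _ (borel X) R nu mu0 mu_ge0 nu_sigma_additive.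
HB.instance Definition _ := Measure_isProbability.Build _ (borel X) R nu nuT.

Lemma finitely_additive_regularization :
  exists nu : probability (borel X) R, Prob nu /\ forall U : set X, open U ->
    (nu U <= (m U)%:E)%E.
Proof.
pose nuP : probability (borel X) R := nu.
exists nuP; split; last first.
  move=> U oU; rewrite /= /regularization outer_content_open// lee_fin.
  exact: inner_content_le_content.
move=> A mA.
have outer (B : set (borel X)) (e : R) : 0 < e ->
  exists U, [/\ open U, B `<=` U & outer_content U <= outer_content B + e].
  move=> e0; have [_ [U [oU BU] <-] hU] := inf_adherent e0 (outer_content_has_inf B).
  by exists U; split => //; rewrite outer_content_open// ltW.
split; apply/eqP; rewrite eq_le; apply/andP; split.
- by apply/ereal_infP => _ [U [oU AU] <-]; exact: mu_mono.
- apply/lee_addgt0Pr => e e0; have [U [oU AU hU]] := outer A e e0.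
  apply: (@le_trans _ _ (nuP U)); first by apply: ereal_inf_lbound; exists U.
  by rewrite /= /regularization -EFinD lee_fin.
- apply/lee_addgt0Pr => e e0; have [U [oU AU hU]] := outer (~` A) e e0.
  have clU : closed (~` U) by exact: open_closedC.
  have mU : measurable (U : set (borel X)) by exact: sub_sigma_algebra.
  apply: (@le_trans _ _ (nuP (~` U) + e%:E)%E); last first.
    rewrite leeD2r//; apply: ereal_sup_ubound; exists (~` U) => //; split.
      by apply: (subclosed_compact clU cX).
    by move=> x nUx; apply: contrapT => nAx; apply: nUx; exact: AU.
  have : nuP (~` A) = (1 - nuP A)%E by exact: probability_setC.
  have : nuP (~` U) = (1 - nuP U)%E by exact: probability_setC.
  rewrite /= /regularization -!EFinB => -[->] [hA]; rewrite -EFinD lee_fin.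
  by move: hU; rewrite hA; lra.
- by apply: ge_ereal_sup => _ [K [cK KA] <-]; exact: mu_mono.
Qed.
End Regularization.

(** * Boundary actions and weakly parabolic subgroups *)

Section BoundaryActions.
Variables (R : realType) (G : groupType) (X : ptopologicalType) (a : left_action G X).

(** By induction on F: the open set for F is not contained in the set of fixed
    points of k, so it contains some x with k x <> x, and can be shrunk around
    x by separating x from k x. *)
Lemma displaced_open : hausdorff_space X -> (forall g, continuous (a g)) ->
  topologically_free a -> forall F : seq G, (forall k, k \in F -> k <> 1%g) ->
  exists U : set X, [/\ open U, U !=set0 & forall k x, k \in F -> U x -> ~ U (a k x)].
Proof.
move=> hX ca free; elim=> [|k F IH] F1.
  by exists setT; split => //; [exact: openT|exists point].
have [U [oU U0 UF]] : exists U : set X, [/\ open U, U !=set0 & forall k x, k \in F ->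
  U x -> ~ U (a k x)].
  by apply: IH => l lF; apply: F1; rewrite inE lF orbT.
have [x [Ux kx]] : exists x, U x /\ a k x <> x.
  apply: contrapT => /forallNP h.
  have Ufix : U `<=` [set x | a k x = x].
    by move=> x Ux; apply: contrapT => kx; apply: (h x).
  have [y Uy] := U0; have : interior [set x | a k x = x] y.
    exact: filterS Ufix (open_nbhs_nbhs (conj oU Uy)).
  by rewrite free//; apply: F1; rewrite inE eqxx.
move: hX; rewrite open_hausdorff => /(_ _ _ (introN eqP kx)).
move=> [[V W] /= [kV xW] [oV oW VW]].
move: kV xW; rewrite !inE => kV xW.
exists (U `&` (W `&` a k @^-1` V)); split.
- by apply: openI => //; apply: openI => //; move/continuousP: (ca k); apply.
- by exists x.
- move=> l y; rewrite inE => /predU1P[->|lF].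
    move=> [_ [_ Vy]] [_ [Wy _]]; have : (V `&` W) (a k y) by [].
    by rewrite (eqP VW).
  by move=> [Uy _] [Uly _]; exact: UF Uy Uly.
Qed.

Lemma measurable_open (U : set X) : open U -> measurable (U : set (borel X)).
Proof. by move=> oU; exact: sub_sigma_algebra. Qed.

Lemma continuous_borel_measurable (f : X -> R) : continuous f ->
  measurable_fun [set: borel X] f.
Proof.
move=> /continuousP cf; apply: (measurability _ (RGenOInfty.measurableE R)).
move=> _ [_ [r ->] <-]; rewrite setTI; apply: measurable_open; apply: cf.
exact: interval_open.
Qed.

(** Translates of nu accumulate at some Dirac mass at x, and by minimality h x is in
    U for some h. Integrals of a Urysohn function for x and h^-1 U then show that
    some translate of nu gives h^-1 U mass at least 1 - e. *)
Lemma strongly_proximal_open (nu : probability (borel X) R) (U : set X) (e : R) :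
  boundary_action R a -> Prob nu -> open U -> U !=set0 -> 0 < e ->
  exists g, ((1 - e)%:E <= nu (a g @^-1` U))%E.
Proof.
move=> [cX hX ca amin prox] Pnu oU U0 e0.
have [x xP] := prox nu Pnu.
have [y0 [Uy0 [h _ hE]]] := amin x U U0 oU.
have oV : open (a h @^-1` U) by move/continuousP: (ca h); apply.
have Vx : (a h @^-1` U) x by rewrite /preimage /= hE.
set V := a h @^-1` U in oV Vx.
have : uniform_separator (~` V) [set x].
  apply: normal_uniform_separator; first exact: compact_normal.
  - exact: open_closedC.
  - exact: (accessible_closed_set1 (hausdorff_accessible hX)).
  - by apply/seteqP; split => // y [/= nVy yx]; apply: nVy; rewrite yx.
move=> /(@uniform_separatorP _ R)[f0 [cf0 f01 fV fx]].
pose f : continuousType X R := HB.pack f0 (isContinuous.Build X R f0 cf0).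
pose ev (mu : weak_star R X) : R := \int[mu]_y f y.
have cev : continuous ev.
  have c1 : continuous ((fun mu : probability (borel X) R =>
      (fun f : continuousType X R => \int[mu]_x f x) : {ptws continuousType X R -> R}) :
      weak_star R X -> {ptws continuousType X R -> R}) by exact: initial_continuous.
  have c2 : continuous (fun phi : {ptws continuousType X R -> R} => phi f).
    exact: (@proj_continuous _ (fun=> R) f).
  by move=> mu; exact: (continuous_comp (c1 mu) (c2 _)).
have mf : measurable_fun [set: borel X] f0 by exact: continuous_borel_measurable.
have evx : ev (\d_(x : borel X)) = 1.
  rewrite /ev /Rintegral integral_dirac//; last exact/measurable_EFinP.
  rewrite diracT mul1e /=; apply: fx; by exists x.
have : nbhs (\d_(x : borel X) : weak_star R X) (ev @^-1` [set r | 1 - e < r]).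
  apply: cev; rewrite evx; apply: open_nbhs_nbhs; split; first exact: open_gt.
  by rewrite /= gtrBl.
move=> /xP[mu [[g gP] /= evmu]].
exists (h * g)%g.
have -> : a (h * g)%g @^-1` U = a g @^-1` V by apply/seteqP; split => y;
  rewrite /V /preimage /= act_mul.
have mV : measurable (V : set (borel X)) by exact: measurable_open.
rewrite -(gP V mV).
apply: le_trans (_ : ((ev mu)%:E <= _)%E); first by rewrite lee_fin ltW.
have f00 y : 0 <= f0 y.
  by have := f01 (f0 y) (ex_intro2 _ _ y I erefl); rewrite /= in_itv /= => /andP[].
have f0V y : f0 y <= \1_V y.
  rewrite indicE; have [Vy|nVy] := boolP (y \in V).
    by have := f01 (f0 y) (ex_intro2 _ _ y I erefl); rewrite /= in_itv /= => /andP[].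
  by rewrite (fV (f0 y))//; exists y => //=; move: nVy; rewrite notin_setE.
have le : (\int[mu]_y (f y)%:E <= mu V)%E.
  apply: (@le_trans _ _ (\int[mu]_y (\1_V y)%:E)%E);
    last by rewrite integral_indic// setIT.
  apply: ge0_le_integral => //.
  - by move=> y _; rewrite lee_fin.
  - exact/measurable_EFinP.
  - by apply/measurable_EFinP; exact: measurable_indic.
  - by move=> y _; rewrite lee_fin f0V.
rewrite /ev /Rintegral fineK// ge0_fin_numE; last by apply: integral_ge0 => y _;
  rewrite lee_fin.
by apply: le_lt_trans le _; apply: (le_lt_trans (probability_le1 mu mV)); exact: ltry.
Qed.

(** Otherwise [finitely_additive_minimax] and regularization provide a regular
    probability that gives mass at most 1 - e to all the translates of U,
    against [strongly_proximal_open]. *)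
Lemma uniform_proximality (U : set X) (e : R) :
  boundary_action R a -> open U -> U !=set0 -> 0 < e ->
  exists n (t : 'I_n -> R) (g : 'I_n -> G),
    [/\ forall i, 0 <= t i, \sum_i t i = 1 & forall x,
      1 - e < \sum_i t i * \1_(a (g i) @^-1` U) x].
Proof.
move=> ba oU U0 e0; apply: contrapT => H.
have [cX hX ca _ _] := ba.
have [n t g t0 t1|m [hm mU]] := @finitely_additive_minimax R X G (fun g =>
  a g @^-1` U) (1 - e) point.
  apply: contrapT => /forallNP h; apply: H; exists n, t, g; split => // x.
  by rewrite ltNge; apply/negP; exact: h.
have [nu [Pnu nuU]] := finitely_additive_regularization hm cX hX.
have e2 : 0 < e / 2 by rewrite divr_gt0.
have [g hg] := strongly_proximal_open ba Pnu oU U0 e2.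
have oUg : open (a g @^-1` U) by move/continuousP: (ca g); apply.
have := le_trans hg (nuU _ oUg); rewrite lee_fin => h.
by have := mU g; lra.
Qed.
End BoundaryActions.

Section WeaklyParabolic.
Variables (R : realType) (G : groupType) (H : groupClosed G).

Definition coset_repr (c : coset_space H) : G := s2val (cid2 (set_mem (valP c))).

Lemma coset_reprP c : left_coset H (coset_repr c) = val c.
Proof. by rewrite /coset_repr; case: cid2. Qed.

Lemma left_coset_eq (g k : G) :
  left_coset H g = left_coset H k -> exists2 h, h \in H & g = (k * h)%g.
Proof.
move=> e; have : left_coset H g g by exists 1%g; [exact: gpred1|rewrite mulg1].
by rewrite e => -[h hH <-]; exists h.
Qed.

(** m_i (c) is the mass of U for the translate of mu by g_i c, which depends only on
    the coset c because H fixes mu. Its value at g_i^-1 k g_i c is the mass of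
    k^-1 U for the same measure, and U and k^-1 U are disjoint. *)
Lemma weakly_parabolic_displacement : weakly_parabolic R H ->
  averaging_displacement R (coset_mul H).
Proof.
move=> [X [a [ba free [mu Pmu inv]]]] F e F1 e0.
have [cX hX ca _ _] := ba.
have [U [oU U0 UF]] := displaced_open hX ca free F1.
have [n [t [g [t0 t1 tg]]]] := uniform_proximality ba oU U0 e0.
have mU k : measurable (a k @^-1` U : set (borel X)).
  by apply: measurable_open; move/continuousP: (ca k); apply.
pose M (k : G) : R := fine (mu (a k @^-1` U)).
have ME k : (M k)%:E = mu (a k @^-1` U) by rewrite fineK// fin_num_measure.
have MH k h : h \in H -> M (k * h)%g = M k.
  move=> hH; apply: EFin_inj; rewrite !ME (inv h hH _ (mU k)); congr (mu _).
  by apply/seteqP; split => x; rewrite /preimage /= act_mul.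
exists n, t, g, (fun i c => M (g i * coset_repr c)%g); split => //.
- move=> i c; rewrite -!lee_fin ME measure_ge0 probability_le1//.
- move=> c; pose r := coset_repr c.
  have [e1|e1] := ltP (1 - e) 0.
    apply: (le_trans (ltW e1)); apply: sumr_ge0 => i _; rewrite mulr_ge0//.
    by rewrite -lee_fin ME measure_ge0.
  pose B i : set (borel X) := a (g i * r)%g @^-1` U.
  have intB : (\int[mu]_x (\sum_(i <- index_enum 'I_n) (t i * \1_(B i) x)%:E))%E =
      (\sum_i t i * M (g i * r)%g)%:E.
    rewrite ge0_integral_sum//.
    + rewrite -sumEFin; apply: eq_bigr => i _.
      under eq_integral do rewrite EFinM.
      rewrite ge0_integralZl//; last by rewrite lee_fin.
        by rewrite (integral_indic mu measurableT (mU _)) setIT EFinM ME.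
      by apply/measurable_EFinP; apply: measurable_indic; exact: mU.
    + by move=> i; apply/measurable_EFinP; apply: measurable_funM => //;
      apply: measurable_indic; exact: mU.
    + by move=> i x _; rewrite lee_fin mulr_ge0.
  rewrite -lee_fin -intB.
  have -> : (1 - e)%:E = (\int[mu]_x (cst (1 - e)%:E x))%E.
    transitivity ((1 - e)%:E * mu setT)%E; first by rewrite (probability_setT mu) mule1.
    by rewrite (integral_cst mu measurableT).
  apply: ge0_le_integral => //.
  + apply: emeasurable_sum => i.
    by apply/measurable_EFinP; apply: measurable_funM => //; apply: measurable_indic;
      exact: mU.
  + move=> x _; rewrite sumEFin lee_fin; apply: ltW; apply: lt_le_trans (tg (a r x)) _.
    apply: ler_sum => i _.
    rewrite (_ : \1_(B i) x = \1_(a (g i) @^-1` U) (a r x))// !indicE.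
    by congr (nat_of_bool _)%:R; apply/idP/idP; rewrite !inE /B /preimage /= act_mul.
- move=> k i c kF; set c' := coset_mul H _ c; pose r := coset_repr c.
  have [h hH rE] : exists2 h, h \in H & coset_repr c' = ((g i)^-1 * k * g i * r * h)%g.
    apply: left_coset_eq; rewrite coset_reprP /c' /= -coset_reprP /left_coset
      image_comp.
    by apply: eq_imagel => x _ /=; rewrite mulgA.
  have -> : M (g i * coset_repr c')%g = M (k * (g i * r))%g.
    by rewrite rE !mulgA mulgV mul1g -!mulgA !mulgA MH.
  rewrite -lee_fin EFinD !ME -measureU//.
    by apply: probability_le1; exact: measurableU.
  apply/seteqP; split => // x [/= Ux Ukx].
  by apply: (UF k _ kF Ux); rewrite -act_mul.
Qed.
End WeaklyParabolic.

Theorem theorem3 (R : realType) (G : groupType) (H : groupClosed G)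
    (countableG : countable [set: G])
    (wparH : weakly_parabolic R H) :
  exists Phi : operator R (coset_space H) -> operator R G,
    let A := cstar_rep (quasi_regular R H) in
    let I := star_hom_kernel A Phi in
    [/\ star_hom A Phi,
        forall g, Phi (quasi_regular R H g) = left_regular R G g,
        quotient_isomorphic A I (cstar_rep (left_regular R G)),
        proper_closed_ideal A I &
        forall J : set (operator R (coset_space H)),
          proper_closed_ideal A J -> J `<=` I].
Proof.
pose c0 : coset_space H := SigSub (mem_set (ex_intro2 _ _ (1%g : G) I erefl) :
  left_coset H 1%g \in range (left_coset H)).
exact: displacement_factorization c0 (weakly_parabolic_displacement wparH).
Qed.
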